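(* In the ring of noncommutative formal power series in $\mathbf u,\mathbf v,\mathbf w,\mathbf t$ with the commutative variable $s$, the following equalities hold: $$S(\mathbf u,\mathbf v,\mathbf w,\mathbf t,1)=N(\mathbf u,\mathbf v,\mathbf w,\mathbf t,1)=\sum_{m=1}^\infty \prod_{k=1}^m \mathbf t\,\mathbf v^{-1}\Bigl[\bigl(1-\mathbf v\mathbf u^{-1}[(1+\mathbf u[1-\mathbf w]^{-1})^k-1]\bigr)^{-1}-1\Bigr]$$ and $$S(\mathbf u,\mathbf v,0,\mathbf t,s)=S_{\rm silly}(\mathbf u,\mathbf v,\mathbf t,s)=N(\mathbf u,\mathbf v,0,\mathbf t,s)=\sum_{m=1}^\infty \prod_{k=1}^m \mathbf t\,\mathbf v^{-1}\Bigl[\bigl(1-\mathbf v\mathbf u^{-1}[(1+\mathbf u)^{k-1}(1+s\mathbf u)-1]\bigr)^{-1}-1\Bigr].$$ Consequently, $\bar S(\mathbf x,\mathbf y,\mathbf z,\mathbf t,1)=\bar N(\mathbf x,\mathbf y,\mathbf z,\mathbf t,1)$ and $\bar S(\mathbf x,\mathbf y,\mathbf y,\mathbf t,s)=\bar S_{\rm silly}(\mathbf x,\mathbf y,\mathbf t,s)=\bar N(\mathbf x,\mathbf y,\mathbf y,\mathbf t,s)$.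
   Context: **Series.** Bold letters are noncommuting variables; $s$ is a commutative variable (commuting with everything). $\langle\langle\cdot\rangle\rangle$-series are formal sums of words with coefficients in $\mathbb C[[s]]$. Products $\prod_{k=1}^m$ are taken in order from left ($k=1$) to right ($k=m$). A series with invertible constant term is invertible. If $X=\mathbf uY$ then $\mathbf u^{-1}X$ denotes the (unique) $Y$, and similarly for $\mathbf v^{-1}$; so $\mathbf v\mathbf u^{-1}X=\mathbf vY$ when $X=\mathbf uY$, and $\mathbf t\mathbf v^{-1}X=\mathbf tY$ when $X=\mathbf vY$. For disjoint $A_1,\dots,A_k\subseteq[n]=\{1,\dots,n\}$, $[\mathbf x_1^{A_1}\cdots\mathbf x_k^{A_k};\mathbf t]_n$ is the product of $n$ factors whose $i$th factor is $\mathbf x_j$ if $i\in A_j$ and $\mathbf t$ if $i\notin A_1\cup\dots\cup A_k$. **Permutations.** $\mathcal S_n$ is the set of permutations $\pi=\pi(1)\cdots\pi(n)$ of $[n]$. An ascent is a value $\pi(j)$ with $j\ge2$ and $\pi(j-1)<\pi(j)$. The ascents are partitioned as follows: $P(\pi)$: ascents $\pi(j)$ such that the value $\pi(j)-1$ occurs to the right of $\pi(j)$; $Q(\pi)$: ascents $\pi(j)$ such that the value $\pi(j)-1$ occurs to the left of $\pi(j-1)$; $\mathrm{Asc}^{\rm short}(\pi)$: ascents $\pi(j)$ with $\pi(j-1)=\pi(j)-1$. A silly ascent is a value $\pi(j)<n$ with $j=1$ or $\pi(j-1)<\pi(j)$. $P_{\rm silly}(\pi)$ (resp. $Q_{\rm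 silly}(\pi)$) is the set of silly ascents $\pi(j)$ such that the value $\pi(j)+1$ occurs to the left (resp. right) of $\pi(j)$. $P^+_{\rm silly}(\pi)=\{i+1: i\in P_{\rm silly}(\pi)\}$, $Q^+_{\rm silly}(\pi)=\{i+1:i\in Q_{\rm silly}(\pi)\}$. $\mathrm{rmin}(\pi)$ is the number of values $\pi(j)$ with $\pi(j)<\pi(k)$ for all $k>j$. **Matchings.** A matching $M$ of size $n$ is a partition of $[2n]$ into 2-element arcs; an arc $A$ has opener $\mathrm{op}(A)=\min A$ and closer $\mathrm{cl}(A)=\max A$. Arcs are numbered $M_1,\dots,M_n$ by increasing closer. A left nesting is a pair of arcs $A,B$ with $\mathrm{op}(B)<\mathrm{op}(A)<\mathrm{cl}(A)<\mathrm{cl}(B)$ and $\mathrm{op}(A)=\mathrm{op}(B)+1$. $\mathcal N_n$ is the set of matchings of size $n$ with no left nesting. Put $\mathrm{Rne}(M)=\{i:\mathrm{op}(M_i)<\mathrm{op}(M_{i-1})<\mathrm{cl}(M_{i-1})=\mathrm{cl}(M_i)-1\}$, $\mathrm{Rcr}(M)=\{i:\mathrm{op}(M_{i-1})<\mathrm{op}(M_i)<\mathrm{cl}(M_{i-1})=\mathrm{cl}(M_i)-1\}$, $\mathrm{LRcr}(M)=\{i:\mathrm{op}(M_{i-1})+1=\mathrm{op}(M_i)<\mathrm{cl}(M_{i-1})=\mathrm{cl}(M_i)-1\}$, $\mathrm{Rcr}^0(M)=\mathrm{Rcr}(M)\setminus\mathrm{LRcr}(M)$, and $\min(M)=\#\{i:\mathrm{op}(M_i)<\mathrm{cl}(M_1)\}$.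 **Generating functions.** $$\bar S(\mathbf x,\mathbf y,\mathbf z,\mathbf t,s)=\sum_{n\ge1}\sum_{\pi\in\mathcal S_n}s^{\mathrm{rmin}(\pi)}[\mathbf x^{P(\pi)}\mathbf y^{Q(\pi)}\mathbf z^{\mathrm{Asc}^{\rm short}(\pi)};\mathbf t]_n,$$ $$\bar S_{\rm silly}(\mathbf x,\mathbf y,\mathbf t,s)=\sum_{n\ge1}\sum_{\pi\in\mathcal S_n}s^{\mathrm{rmin}(\pi)}[\mathbf x^{P^+_{\rm silly}(\pi)}\mathbf y^{Q^+_{\rm silly}(\pi)};\mathbf t]_n,$$ $$\bar N(\mathbf x,\mathbf y,\mathbf z,\mathbf t,s)=\sum_{n\ge1}\sum_{M\in\mathcal N_n}s^{\min(M)}[\mathbf x^{\mathrm{Rne}(M)}\mathbf y^{\mathrm{Rcr}^0(M)}\mathbf z^{\mathrm{LRcr}(M)};\mathbf t]_n,$$ and $S(\mathbf u,\mathbf v,\mathbf w,\mathbf t,s)=\bar S(\mathbf u+\mathbf v+\mathbf t,\mathbf v+\mathbf t,\mathbf v+\mathbf w+\mathbf t,\mathbf t,s)$, $S_{\rm silly}(\mathbf u,\mathbf v,\mathbf t,s)=\bar S_{\rm silly}(\mathbf u+\mathbf v+\mathbf t,\mathbf v+\mathbf t,\mathbf t,s)$, $N(\mathbf u,\mathbf v,\mathbf w,\mathbf t,s)=\bar N(\mathbf u+\mathbf v+\mathbf t,\mathbf v+\mathbf t,\mathbf v+\mathbf w+\mathbf t,\mathbf t,s)$. *)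

(* Defs.v *)
From HB Require Import structures.
From mathcomp Require Import all_boot all_order all_algebra all_fingroup.
From mathcomp Require Import boolp classical_sets fsbigop cardinality.
From mathcomp Require Import reals.
From mathcomp Require Import complex.

Set Implicit Arguments.
Unset Strict Implicit.
Unset Printing Implicit Defensive.

Import GRing.Theory.
Local Open Scope ring_scope.

(** [K[[s]]], the function [f] standing for the sum of the [f n * s ^ n]; a
    record, since functions already carry the pointwise ring structure. *)
Record fps (K : Type) := FPS { fcoef :> nat -> K }.

Section Fps.
Variable K : comNzRingType.
Implicit Types f g h : fps K.

Lemma fpsP f g : (forall n, f n = g n) -> f = g.
Proof. by case: f g => [f] [g] /= fg; congr FPS; apply: funext. Qed.

HB.instance Definition _ := gen_eqMixin (fps K).
HB.instance Definition _ := gen_choiceMixin (fps K).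

Definition fps0 : fps K := FPS (fun=> 0).
Definition fps_opp f : fps K := FPS (fun n => - f n).
Definition fps_add f g : fps K := FPS (fun n => f n + g n).
Definition fps1 : fps K := FPS (fun n => (n == 0%N)%:R).
Definition fps_mul f g : fps K := FPS (fun n => \sum_(i < n.+1) f i * g (n - i)%N).

Definition fpsX : fps K := FPS (fun n => (n == 1%N)%:R).

Fact fps_addA : associative fps_add.
Proof. by move=> f g h; apply: fpsP => n /=; rewrite addrA. Qed.
Fact fps_addC : commutative fps_add.
Proof. by move=> f g; apply: fpsP => n /=; rewrite addrC. Qed.
Fact fps_add0 : left_id fps0 fps_add.
Proof. by move=> f; apply: fpsP => n /=; rewrite add0r. Qed.
Fact fps_addN : left_inverse fps0 fps_opp fps_add.
Proof. by move=> f; apply: fpsP => n /=; rewrite addNr. Qed.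

HB.instance Definition _ :=
  GRing.isZmodule.Build (fps K) fps_addA fps_addC fps_add0 fps_addN.

Let shift f : fps K := FPS (fun n => f n.+1).

Let fps_mulS f g n : fps_mul f g n.+1 = f 0%N * g n.+1 + fps_mul (shift f) g n.
Proof. by rewrite /= big_ord_recl; congr (_ + _); apply: eq_bigr. Qed.

Let fps_mul0 f g : fps_mul f g 0%N = f 0%N * g 0%N.
Proof. by rewrite /= big_ord_recl big_ord0 addr0. Qed.

Fact fps_mulC : commutative fps_mul.
Proof.
move=> f g; apply: fpsP => n /=; rewrite (reindex_inj rev_ord_inj) /=.
by apply: eq_bigr => i _; rewrite subSS subKn 1?mulrC // -ltnS.
Qed.

Fact fps_mulDl : left_distributive fps_mul fps_add.
Proof.
move=> f g h; apply: fpsP => n /=; rewrite -big_split.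
by apply: eq_bigr => i _; rewrite mulrDl.
Qed.

Fact fps_mulA : associative fps_mul.
Proof.
move=> f g h; apply: fpsP => n; elim: n f => [|n IH] f.
  by rewrite !fps_mul0 mulrA.
rewrite 2!fps_mulS [in RHS]fps_mulS fps_mul0 IH mulrDr -!addrA mulrA; congr (_ + _).
have -> : shift (fps_mul f g) =
    fps_add (FPS (fun i => f 0%N * g i.+1)) (fps_mul (shift f) g).
  by apply: fpsP => i; rewrite [LHS]fps_mulS.
rewrite fps_mulDl; congr (_ + _); rewrite /= mulr_sumr.
by apply: eq_bigr => i _; rewrite mulrA.
Qed.

Fact fps_mul1 : left_id fps1 fps_mul.
Proof.
move=> f; apply: fpsP => n /=; rewrite big_ord_recl /= mul1r subn0.
by rewrite big1 ?addr0 // => i _; rewrite mul0r.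
Qed.

Fact fps1_neq0 : fps1 != 0.
Proof. by apply/eqP => /(congr1 (fun f => fcoef f 0%N))/eqP; rewrite oner_eq0. Qed.

HB.instance Definition _ := GRing.Zmodule_isComNzRing.Build (fps K)
  fps_mulA fps_mulC fps_mul1 fps_mulDl fps1_neq0.

End Fps.

(** Formal sums of words in the letters [A], the word [w] having coefficient
    [f w]; scalars commute with the words. *)
Record ncps (A K : Type) := NCPS { ncoef :> seq A -> K }.

Section Ncps.
Variables (A : eqType) (K : comNzRingType).
Implicit Types f g h : ncps A K.

Lemma ncpsP f g : (forall w, f w = g w) -> f = g.
Proof. by case: f g => [f] [g] /= fg; congr NCPS; apply: funext. Qed.

HB.instance Definition _ := gen_eqMixin (ncps A K).
HB.instance Definition _ := gen_choiceMixin (ncps A K).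

Definition nc0 : ncps A K := NCPS (fun=> 0).
Definition nc_opp f : ncps A K := NCPS (fun w => - f w).
Definition nc_add f g : ncps A K := NCPS (fun w => f w + g w).
Definition nc1 : ncps A K := NCPS (fun w => (w == [::])%:R).
Definition nc_mul f g : ncps A K :=
  NCPS (fun w => \sum_(i < (size w).+1) f (take i w) * g (drop i w)).
Definition nc_scale (c : K) f : ncps A K := NCPS (fun w => c * f w).

Definition letter (a : A) : ncps A K := NCPS (fun w => (w == [:: a])%:R).

Fact nc_addA : associative nc_add.
Proof. by move=> f g h; apply: ncpsP => n /=; rewrite addrA. Qed.
Fact nc_addC : commutative nc_add.
Proof. by move=> f g; apply: ncpsP => n /=; rewrite addrC. Qed.
Fact nc_add0 : left_id nc0 nc_add.
Proof. by move=> f; apply: ncpsP => n /=; rewrite add0r. Qed.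
Fact nc_addN : left_inverse nc0 nc_opp nc_add.
Proof. by move=> f; apply: ncpsP => n /=; rewrite addNr. Qed.

HB.instance Definition _ :=
  GRing.isZmodule.Build (ncps A K) nc_addA nc_addC nc_add0 nc_addN.

Let shift a f : ncps A K := NCPS (fun w => f (a :: w)).

Let nc_mul_cons f g a w :
  nc_mul f g (a :: w) = f [::] * g (a :: w) + nc_mul (shift a f) g w.
Proof. by rewrite /= big_ord_recl; congr (_ + _); apply: eq_bigr. Qed.

Let nc_mul_nil f g : nc_mul f g [::] = f [::] * g [::].
Proof. by rewrite /= big_ord_recl big_ord0 addr0. Qed.

Fact nc_mulDl : left_distributive nc_mul nc_add.
Proof.
move=> f g h; apply: ncpsP => w /=; rewrite -big_split.
by apply: eq_bigr => i _; rewrite mulrDl.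
Qed.

Fact nc_mulDr : right_distributive nc_mul nc_add.
Proof.
move=> f g h; apply: ncpsP => w /=; rewrite -big_split.
by apply: eq_bigr => i _; rewrite mulrDr.
Qed.

Fact nc_scaleAl c f g : nc_scale c (nc_mul f g) = nc_mul (nc_scale c f) g.
Proof.
apply: ncpsP => w /=; rewrite mulr_sumr.
by apply: eq_bigr => i _; rewrite mulrA.
Qed.

Fact nc_scaleAr c f g : nc_scale c (nc_mul f g) = nc_mul f (nc_scale c g).
Proof.
apply: ncpsP => w /=; rewrite mulr_sumr.
by apply: eq_bigr => i _; rewrite mulrCA.
Qed.

Fact nc_mulA : associative nc_mul.
Proof.
move=> f g h; apply: ncpsP => w; elim: w f => [|a w IH] f.
  by rewrite !nc_mul_nil mulrA.
rewrite 2!nc_mul_cons [in RHS]nc_mul_cons nc_mul_nil IH mulrDr -!addrA mulrA.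
congr (_ + _).
have -> : shift a (nc_mul f g) =
    nc_add (nc_scale (f [::]) (shift a g)) (nc_mul (shift a f) g).
  by apply: ncpsP => i; rewrite [LHS]nc_mul_cons.
by rewrite nc_mulDl -nc_scaleAl.
Qed.

Fact nc_mul1l : left_id nc1 nc_mul.
Proof.
move=> f; apply: ncpsP => -[|a w]; first by rewrite nc_mul_nil mul1r.
rewrite nc_mul_cons mul1r /= big1 ?addr0 // => i _.
by rewrite mul0r.
Qed.

Fact nc_mul1r : right_id nc1 nc_mul.
Proof.
move=> f; apply: ncpsP => w; elim: w f => [|a w IH] f.
  by rewrite nc_mul_nil mulr1.
by rewrite nc_mul_cons mulr0 add0r IH.
Qed.

Fact nc1_neq0 : nc1 != 0.
Proof.
by apply/eqP => /(congr1 (fun f => ncoef f [::]))/eqP; rewrite oner_eq0.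
Qed.

HB.instance Definition _ := GRing.Zmodule_isNzRing.Build (ncps A K)
  nc_mulA nc_mul1l nc_mul1r nc_mulDl nc_mulDr nc1_neq0.

Fact nc_scaleA a b f : nc_scale a (nc_scale b f) = nc_scale (a * b) f.
Proof. by apply: ncpsP => w /=; rewrite mulrA. Qed.
Fact nc_scale1 : left_id 1 nc_scale.
Proof. by move=> f; apply: ncpsP => w /=; rewrite mul1r. Qed.
Fact nc_scaleDr : right_distributive nc_scale +%R.
Proof. by move=> c f g; apply: ncpsP => w /=; rewrite mulrDr. Qed.
Fact nc_scaleDl f : {morph nc_scale^~ f : a b / a + b}.
Proof. by move=> a b; apply: ncpsP => w /=; rewrite mulrDl. Qed.

HB.instance Definition _ := GRing.Zmodule_isLmodule.Build K (ncps A K)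
  nc_scaleA nc_scale1 nc_scaleDr nc_scaleDl.
HB.instance Definition _ := GRing.Lmodule_isLalgebra.Build K (ncps A K)
  nc_scaleAl.
HB.instance Definition _ := GRing.Lalgebra_isAlgebra.Build K (ncps A K)
  nc_scaleAr.

Definition nc_unit : pred (ncps A K) :=
  fun f => `[< exists g, g * f = 1 /\ f * g = 1 >].
Definition nc_inv f : ncps A K :=
  if nc_unit f then xget 0 [set g | g * f = 1 /\ f * g = 1]%classic else f.

Let nc_invP f : nc_unit f -> nc_inv f * f = 1 /\ f * nc_inv f = 1.
Proof.
move=> uf; rewrite /nc_inv uf; move/asboolP: uf => [g gP].
exact: (@xgetPex _ 0 [set g | g * f = 1 /\ f * g = 1]%classic (ex_intro _ g gP)).
Qed.

Fact nc_mulVr : {in nc_unit, left_inverse 1 nc_inv *%R}.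
Proof. by move=> f /nc_invP[]. Qed.
Fact nc_mulrV : {in nc_unit, right_inverse 1 nc_inv *%R}.
Proof. by move=> f /nc_invP[]. Qed.
Fact nc_unitP f g : g * f = 1 /\ f * g = 1 -> nc_unit f.
Proof. by move=> fg; apply/asboolP; exists g. Qed.
Fact nc_inv_out : {in [predC nc_unit], nc_inv =1 id}.
Proof. by move=> f uf; rewrite /nc_inv ifN. Qed.

HB.instance Definition _ := GRing.NzRing_hasMulInverse.Build (ncps A K)
  nc_mulVr nc_mulrV nc_unitP nc_inv_out.

(** [ldiv f h] is the [g] with [h = f * g]; it is only meant to be used when
    this [g] exists and is unique, see [ldivK]. *)
Definition ldiv f h : ncps A K := xget 0 [set g | h = f * g]%classic.

(** The sum of the family [F n], for [n] in [D]: every coefficient is the sum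
    of the finitely many nonzero coefficients of the [F n]. *)
Definition ncsum (D : set nat) (F : nat -> ncps A K) : ncps A K :=
  NCPS (fun w => \sum_(n \in D) F n w).

Lemma nc_coefD f g w : (f + g) w = f w + g w. Proof. by []. Qed.
Lemma nc_coefN f w : (- f) w = - f w. Proof. by []. Qed.
Lemma nc_coefM f g w :
  (f * g) w = \sum_(i < (size w).+1) f (take i w) * g (drop i w).
Proof. by []. Qed.

Lemma letterM_nil a f : (letter a * f) [::] = 0.
Proof. by rewrite [LHS]nc_mul_nil mul0r. Qed.

Lemma letterM_cons a f b w : (letter a * f) (b :: w) = (b == a)%:R * f w.
Proof.
rewrite [LHS]nc_mul_cons mul0r add0r /= big_ord_recl /= take0 drop0.
rewrite eqseq_cons eqxx andbT big1 ?addr0 // => i _.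
by case: w i => [[] //|c w] i; rewrite eqseq_cons andbF mul0r.
Qed.

Lemma letterM_inj a : injective (fun f => letter a * f).
Proof.
move=> f g /= fg; apply: ncpsP => w.
have : (letter a * f) (a :: w) = (letter a * g) (a :: w) by rewrite fg.
by rewrite !letterM_cons eqxx !mul1r.
Qed.

Lemma ldivK a f : ldiv (letter a) (letter a * f) = f.
Proof.
by apply: xget_subset1 => //= g h -> /letterM_inj.
Qed.

Lemma letterM_exp a f k :
  exists g, (1 + letter a * f) ^+ k - 1 = letter a * g.
Proof.
elim: k => [|k [g kE]]; first by exists 0; rewrite expr0 subrr mulr0.
exists (f * (1 + letter a * f) ^+ k + g).
rewrite exprS mulrDl mul1r addrAC kE mulrDr mulrA; exact: addrC.
Qed.

Definition ord_ge f (n : nat) := forall w, (size w < n)%N -> f w = 0.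

Lemma ord_geD f g n : ord_ge f n -> ord_ge g n -> ord_ge (f + g) n.
Proof. by move=> fn gn w wn; rewrite nc_coefD fn // gn // addr0. Qed.

Lemma ord_geZ c f n : ord_ge f n -> ord_ge (c *: f) n.
Proof. by move=> fn w wn; rewrite -[LHS]/(c * f w) fn // mulr0. Qed.

Lemma ord_ge_sum (I : finType) (P : pred I) (F : I -> ncps A K) n :
  (forall i, P i -> ord_ge (F i) n) -> ord_ge (\sum_(i | P i) F i) n.
Proof.
by move=> FP; apply: (big_ind (ord_ge^~ n)) => // f g; apply: ord_geD.
Qed.

Lemma ord_geM f g m n : ord_ge f m -> ord_ge g n -> ord_ge (f * g) (m + n).
Proof.
move=> fm gn w wmn; rewrite nc_coefM big1 // => i _.
have [im|mi] := ltnP i m.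
  by rewrite fm ?mul0r // (leq_ltn_trans _ im) // size_take_min geq_minl.
rewrite gn ?mulr0 // size_drop ltn_subLR; last by rewrite -ltnS.
by apply: leq_trans wmn _; rewrite leq_add2r.
Qed.

Lemma ord_ge_prod n (F : 'I_n -> ncps A K) :
  (forall i, ord_ge (F i) 1) -> ord_ge (\prod_(i < n) F i) n.
Proof.
elim: n F => [|n IH] F F1; first by [].
by rewrite big_ord_recl; apply: (@ord_geM _ _ 1 n) => //; apply: IH.
Qed.

Lemma ord_geX f n : ord_ge f 1 -> ord_ge (f ^+ n) n.
Proof.
move=> f1; elim: n => [|n IH]; first by [].
by rewrite exprS; apply: (@ord_geM _ _ 1 n).
Qed.

Lemma letter_ord a : ord_ge (letter a) 1.
Proof. by case. Qed.

(** All the families summed in practice satisfy [ord_ge (F n) n], so that each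
    coefficient of their sum is an honest finite sum. *)
Lemma ncsumE (F : nat -> ncps A K) m n w :
    (forall k, ord_ge (F k) k) -> (size w < n)%N ->
  ncsum [set k | (m <= k)%N]%classic F w = \sum_(m <= k < n) F k w.
Proof.
move=> FP wn; rewrite -[LHS]/(\sum_(k \in [set k | (m <= k)%N]%classic) F k w).
rewrite -(@fsbig_widen _ _ _ _ [set` index_iota m n]%classic).
- by rewrite -fsbig_seq // iota_uniq.
- by move=> k /=; rewrite mem_index_iota => /andP[].
- move=> k [/= mk /negP]; rewrite mem_index_iota mk /= -leqNgt => nk.
  by apply: FP; apply: leq_trans wn nk.
Qed.

Lemma nc_unit1B f : ord_ge f 1 -> 1 - f \is a GRing.unit.
Proof.
move=> f1; pose g := ncsum [set k | (0 <= k)%N]%classic (GRing.exp f).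
have fX k : ord_ge (f ^+ k) k by apply: ord_geX.
have gE n w : (size w < n)%N -> g w = (\sum_(k < n) f ^+ k) w.
  move=> wn; rewrite /g (ncsumE 0 fX wn) big_mkord.
  by rewrite (@big_morph _ _ (fun h : ncps A K => h w) 0 +%R 0 +%R).
have tele n : (1 - f) * (\sum_(k < n) f ^+ k) = 1 - f ^+ n.
  by rewrite -[RHS]opprB subrX1 -mulNr opprB.
have comm n : (\sum_(k < n) f ^+ k) * (1 - f) = 1 - f ^+ n.
  rewrite -tele; apply: commr_sym; apply: commr_sum => k _.
  by apply: commrX; apply: commr_sym; apply: commrB => //; apply: commr1.
apply/asboolP; exists g; split; apply: ncpsP => w; set n := (size w).+1.
- transitivity (((\sum_(k < n) f ^+ k) * (1 - f)) w).
    rewrite !nc_coefM; apply: eq_bigr => i _; congr (_ * _).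
    by apply: gE; rewrite ltnS size_take_min geq_minr.
  by rewrite comm nc_coefD nc_coefN fX // subr0.
- transitivity (((1 - f) * (\sum_(k < n) f ^+ k)) w).
    rewrite !nc_coefM; apply: eq_bigr => i _; congr (_ * _).
    by apply: gE; rewrite ltnS size_drop leq_subr.
  by rewrite tele nc_coefD nc_coefN fX // subr0.
Qed.

(** The bracket [x_1^{A_1} ... x_k^{A_k}; t]_n, for disjoint [A_1, ..., A_k]. *)
Definition bracket n (xs : seq (ncps A K * {set 'I_n})) (t : ncps A K)
    : ncps A K :=
  \prod_(i < n)
    foldr (fun (p : ncps A K * {set 'I_n}) y => if i \in p.2 then p.1 else y) t xs.

Lemma bracket_ord n (xs : seq (ncps A K * {set 'I_n})) (t : ncps A K) :
    ord_ge t 1 -> (forall x, x \in [seq q.1 | q <- xs] -> ord_ge x 1) ->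
  ord_ge (bracket xs t) n.
Proof.
move=> t1 xs1; apply: ord_ge_prod => i.
elim: xs xs1 => [|p xs IH] //= xs1; case: ifP => _.
  by apply: xs1; rewrite inE eqxx.
by apply: IH => x xxs; apply: xs1; rewrite inE xxs orbT.
Qed.

End Ncps.

(** Positions and values are elements of ['I_n], so they are shifted by one
    with respect to [{1, ..., n}]. *)

Section Permutations.
Variables (n : nat) (p : 'S_n).

(** Below, [j] is the position of the ascent and [i = j - 1]. *)
Definition ascent_at (i j : 'I_n) := (j == i.+1 :> nat) && (p i < p j)%N.

Definition Pasc : {set 'I_n} :=
  [set v : 'I_n | [exists i, exists j, exists k,
    [&& ascent_at i j, v == p j, p j == (p k).+1 :> nat & (j < k)%N]]].

Definition Qasc : {set 'I_n} :=
  [set v : 'I_n | [exists i, exists j, exists k,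
    [&& ascent_at i j, v == p j, p j == (p k).+1 :> nat & (k < i)%N]]].

Definition Asc_short : {set 'I_n} :=
  [set v : 'I_n | [exists i, exists j,
    [&& ascent_at i j, v == p j & p j == (p i).+1 :> nat]]].

Definition silly_ascent_at (j : 'I_n) :=
  ((p j).+1 < n)%N && ((j == 0%N :> nat) || [exists i, ascent_at i j]).

Definition Psilly : {set 'I_n} :=
  [set v : 'I_n | [exists j, exists k,
    [&& silly_ascent_at j, v == p j, p k == (p j).+1 :> nat & (k < j)%N]]].

Definition Qsilly : {set 'I_n} :=
  [set v : 'I_n | [exists j, exists k,
    [&& silly_ascent_at j, v == p j, p k == (p j).+1 :> nat & (j < k)%N]]].

Definition succ_set (B : {set 'I_n}) : {set 'I_n} :=
  [set v : 'I_n | [exists i in B, v == i.+1 :> nat]].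

Definition rmin : nat :=
  #|[set p j | j : 'I_n & [forall k : 'I_n, (j < k)%N ==> (p j < p k)%N]]|.

End Permutations.

(** The points are the elements of ['I_(n.*2)], so they are shifted by one with
    respect to [{1, ..., 2n}]. *)

Section Matchings.
Variable n : nat.
Implicit Types (B C : {set 'I_n.*2}) (M : {set {set 'I_n.*2}}).

Definition is_matching M :=
  finset.partition M [set: 'I_n.*2] && [forall B in M, #|B| == 2%N].

Definition opener B : nat := \big[minn/n.*2]_(i in B) i.
Definition closer B : nat := \max_(i in B) i.

Definition left_nesting B C :=
  [&& (opener C < opener B)%N, (opener B < closer B)%N, (closer B < closer C)%N
    & opener B == (opener C).+1].

Definition Nmatchings : {set {set {set 'I_n.*2}}} :=
  [set M | is_matching M &&
    [forall B in M, forall C in M, ~~ left_nesting B C]].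

(** The arcs numbered from 0 on by increasing closer, instead of from 1 on. *)
Definition numbered_arc M (i : nat) : {set 'I_n.*2} :=
  nth finset.set0 (sort (fun B C => (closer B <= closer C)%N) (enum M)) i.

Definition Rne M : {set 'I_n} :=
  [set i : 'I_n | (0 < i)%N &&
    (let B := numbered_arc M i.-1 in let C := numbered_arc M i in
    [&& (opener C < opener B)%N, (opener B < closer B)%N & closer C == (closer B).+1])].

Definition Rcr M : {set 'I_n} :=
  [set i : 'I_n | (0 < i)%N &&
    (let B := numbered_arc M i.-1 in let C := numbered_arc M i in
    [&& (opener B < opener C)%N, (opener C < closer B)%N & closer C == (closer B).+1])].

Definition LRcr M : {set 'I_n} :=
  [set i : 'I_n | (0 < i)%N &&
    (let B := numbered_arc M i.-1 in let C := numbered_arc M i in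
    [&& opener C == (opener B).+1, (opener C < closer B)%N & closer C == (closer B).+1])].

Definition Rcr0 M : {set 'I_n} := Rcr M :\: LRcr M.

Definition min_stat M : nat :=
  #|[set i : 'I_n | (opener (numbered_arc M i) < closer (numbered_arc M 0))%N]|.

End Matchings.

Section GeneratingFunctions.
Variables (A : eqType) (K : comNzRingType).
Implicit Types (x y z t u v w : ncps A K) (s : K).

Definition Sbar x y z t s : ncps A K :=
  ncsum [set n | (1 <= n)%N]%classic (fun n => \sum_(p : 'S_n)
    s ^+ rmin p *: bracket [:: (x, Pasc p); (y, Qasc p); (z, Asc_short p)] t).

Definition Sbar_silly x y t s : ncps A K :=
  ncsum [set n | (1 <= n)%N]%classic (fun n => \sum_(p : 'S_n)
    s ^+ rmin p *:
      bracket [:: (x, succ_set (Psilly p)); (y, succ_set (Qsilly p))] t).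

Definition Nbar x y z t s : ncps A K :=
  ncsum [set n | (1 <= n)%N]%classic (fun n => \sum_(M in Nmatchings n)
    s ^+ min_stat M *: bracket [:: (x, Rne M); (y, Rcr0 M); (z, LRcr M)] t).

Definition Sgf u v w t s := Sbar (u + v + t) (v + t) (v + w + t) t s.
Definition Sgf_silly u v t s := Sbar_silly (u + v + t) (v + t) t s.
Definition Ngf u v w t s := Nbar (u + v + t) (v + t) (v + w + t) t s.

End GeneratingFunctions.

(* Main.v *)
Require Import Defs.
From mathcomp Require Import all_boot all_order all_algebra all_fingroup.
From mathcomp Require Import boolp classical_sets reals complex zify.
Import GRing.Theory.
Local Open Scope ring_scope.
Local Open Scope complex_scope.

Set Implicit Arguments.
Unset Strict Implicit.
Unset Printing Implicit Defensive.

(** Put [u = x - y], [v = y - t], [w = z - y] and expand every bracket into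
    words in four marks.  The coefficient of a word counts the permutations (or
    matchings) that satisfy, for each [v], "is an ascent", for each [u], the
    condition of [P] and, for each [w], that of the short ascents, nothing being
    asked for a [t].  In all three models these objects are encoded by the same
    labelled words: the [i]-th letter gets a label among the [k] letters [t] seen
    so far, which is arbitrary for [t] and [v], smaller than the previous label
    for [u], and equal to it for [w].

    - For permutations, cut in front of every letter [t]: the values are inserted
      in increasing order, and the label is the rank of the block receiving the
      new value; right-to-left minima are the insertions with the last label.
    - For silly ascents the same insertion is used, with a virtual value [0] at
      the left end, and the letter [i + 1] telling whether a block may be
      inserted just before the value [i].
    - A matching without left nesting is determined by the numbers [d i] of
      arcs closed before the arc [i] opens, and these are arbitrary subject to
      [d i <= i].  The closers [i - 1] and [i] are adjacent when [i] is not a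
      value of [d], so that the values of [d] are positions of letters [t], whose
      ranks are the labels; [min] counts the labels that are first.

    The labels below a fixed [k] form, between two letters [v] or [t], a strictly
    decreasing sequence in [1, ..., k] decorated with [w]'s, whence the factors
    [(1 + u (1 - w)^-1) ^ (k - 1) (1 + s u (1 - w)^-1)].  Giving the weight [s] to
    the first or to the last label makes no difference, because these factors
    commute; this needs [s w = w], which covers both [s = 1] and [w = 0]. *)

(** * Series of labelled words *)

Inductive mark := mU | mV | mW | mT.

Definition marks := [:: mU; mV; mW; mT].

Definition is_t c := if c is mT then true else false.
Definition is_u c := if c is mU then true else false.
Definition is_w c := if c is mW then true else false.

(** Whether the letter [c] may get the label [q] after a letter labelled [p];
    labels are counted from 0 on. *)
Definition step_ok c (p q : nat) :=
  match c with mU => (q < p)%N | mW => q == p | _ => true end.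

Section Series.
Variables (A : eqType) (K : comNzRingType).
Implicit Types (f g h : ncps A K) (N : nat).

Definition eqm N f g := forall x : seq A, (size x < N)%N -> f x = g x.

Lemma eqm_eq f g : (forall N, eqm N f g) -> f = g.
Proof. by move=> fg; apply: ncpsP => x; apply: (fg (size x).+1). Qed.

Lemma eqm_trans N g f h : eqm N f g -> eqm N g h -> eqm N f h.
Proof. by move=> fg gh x xN; rewrite fg ?gh. Qed.

Lemma eqm_sym N f g : eqm N f g -> eqm N g f.
Proof. by move=> fg x xN; rewrite fg. Qed.

Lemma eqmD N f f' g g' : eqm N f f' -> eqm N g g' -> eqm N (f + g) (f' + g').
Proof. by move=> ff gg x xN; rewrite !nc_coefD ff ?gg. Qed.

Lemma eqmZ N (a : K) f f' : eqm N f f' -> eqm N (a *: f) (a *: f').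
Proof. by move=> ff x xN; rewrite -[LHS]/(a * f x) ff. Qed.

Lemma eqm_sum N (I : Type) (r : seq I) (P : pred I) (F G : I -> ncps A K) :
  (forall i, P i -> eqm N (F i) (G i)) ->
  eqm N (\sum_(i <- r | P i) F i) (\sum_(i <- r | P i) G i).
Proof.
move=> FG; elim/big_rec2: _ => // i f g Pi fg.
by apply: eqmD => //; apply: FG.
Qed.

(** Since [f] has no constant term, only proper suffixes of a word are read in [g] and [h], whence
    the gain of one degree. *)
Lemma eqmMl N f g h : ord_ge f 1 -> eqm N g h -> eqm N.+1 (f * g) (f * h).
Proof.
move=> f1 gh x xN; rewrite !nc_coefM; apply: eq_bigr => -[[|i] /= iN] _.
  by rewrite take0 f1 ?mul0r.
by congr (_ * _); apply: gh; rewrite size_drop; lia.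
Qed.

Lemma ord_geM1 f g N : ord_ge f 1 -> ord_ge g N -> ord_ge (f * g) N.+1.
Proof. by move=> f1 gN; apply: (@ord_geM _ _ _ _ 1 N). Qed.

Lemma ord_geN f N : ord_ge f N -> ord_ge (- f) N.
Proof. by move=> fN x xN; rewrite nc_coefN fN ?oppr0. Qed.

Lemma ord_geMr f g N : ord_ge f N -> ord_ge (f * g) N.
Proof. by move=> fN; rewrite -[N]addn0; apply: ord_geM. Qed.

Lemma ord_ge_big N (I : Type) (r : seq I) (P : pred I) (F : I -> ncps A K) :
  (forall i, P i -> ord_ge (F i) N) -> ord_ge (\sum_(i <- r | P i) F i) N.
Proof. by move=> FN; elim/big_rec: _ => // i f Pi; apply: ord_geD; apply: FN. Qed.

(** Identities between infinite sums are checked below each length [N], where finitely many terms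
    matter. *)
Lemma eqm_ncsum N (F : nat -> ncps A K) m :
  (forall k, ord_ge (F k) k) ->
  eqm N (ncsum [set k | (m <= k)%N]%classic F) (\sum_(m <= k < N) F k).
Proof.
move=> FP x xN; rewrite (ncsumE m FP xN).
by rewrite (@big_morph _ _ (fun h : ncps A K => h x) 0 +%R 0 +%R).
Qed.

Lemma eq_ncsum D (F G : nat -> ncps A K) : F =1 G -> ncsum D F = ncsum D G.
Proof. by move=> FG; congr ncsum; apply: funext. Qed.

Variable wt : nat -> nat -> K.
Variable lt : mark -> ncps A K.
Hypothesis lt1 : forall c, ord_ge (lt c) 1.

(** The labelled words of length [n] that may follow a word with [k] letters
    [mT] and last label [p]; [wt k q] is the weight of the label [q] among [k]. *)
Fixpoint pathgf n k p : ncps A K :=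
  if n is n'.+1 then
    \sum_(c <- marks) lt c *
      \sum_(q < k + is_t c | step_ok c p q) wt (k + is_t c) q *: pathgf n' (k + is_t c) q
  else 1.

Lemma pathgf_ord n k p : ord_ge (pathgf n k p) n.
Proof.
elim: n k p => [|n IH] k p //=; apply: ord_ge_big => c _.
by apply: ord_geM1 => //; apply: ord_ge_big => q _; apply: ord_geZ.
Qed.

Definition pathser k p : ncps A K :=
  ncsum [set n | (0 <= n)%N]%classic (fun n => pathgf n k p).

Lemma eqm_pathser N k p : eqm N (pathser k p) (\sum_(0 <= n < N) pathgf n k p).
Proof. by apply: eqm_ncsum => n; apply: pathgf_ord. Qed.

Lemma pathserE k p : pathser k p = 1 + \sum_(c <- marks) lt c *
  \sum_(q < k + is_t c | step_ok c p q) wt (k + is_t c) q *: pathser (k + is_t c) q.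
Proof.
apply: eqm_eq => -[//|N]; apply: eqm_trans; first exact: eqm_pathser.
rewrite big_nat_recl //=; apply: eqmD => //.
rewrite exchange_big; apply: eqm_sum => c _.
rewrite -mulr_sumr; apply: eqmMl => //; rewrite exchange_big.
apply: eqm_sum => q _; rewrite -scaler_sumr; apply: eqmZ.
exact/eqm_sym/eqm_pathser.
Qed.

Lemma ncsum_pathgf p :
  1 + ncsum [set n | (1 <= n)%N]%classic (fun n => pathgf n 0 p) = pathser 0 p.
Proof.
apply: eqm_eq => -[//|N]; apply: eqm_trans; last exact/eqm_sym/eqm_pathser.
rewrite big_ltn //; apply: eqmD => //.
by apply: eqm_ncsum => n; apply: pathgf_ord.
Qed.

Local Notation u := (lt mU).
Local Notation v := (lt mV).
Local Notation w := (lt mW).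
Local Notation t := (lt mT).

(** A letter [mW] repeats a label, which is then weighted again; the hypothesis absorbs this extra
    weight, so that a run of [mW] contributes the plain geometric series [e]. *)
Hypothesis wt_w : forall k p, (p < k)%N -> wt k p *: w = w.

Let e := (1 - w)^-1.

(** [T k] collects the continuations after a letter whose label is free among [k], with the weight
    of that label; [X k] keeps the continuations that are empty or begin with [mT] or [mV]. *)
Let T k := \sum_(p < k) wt k p *: pathser k p.
Let X k := 1 + t * T k.+1 + v * T k.

(** The decreasing sequences of labels below [p], each label followed by any
    number of letters [mW]. *)
Fixpoint chain k p : ncps A K :=
  if p is p'.+1 then chain k p' + wt k p' *: (u * e * chain k p') else 1.

(** The series of a block: the free label [p] of its first letter, then letters [mW] and [mU] only.
    The first letter itself, [mT] or [mV], is left out. *)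
Definition blockser k : ncps A K := \sum_(p < k) wt k p *: (e * chain k p).

(** In [pathserE] the term of [mW] is moved to the left and [1 - w] is inverted; the summand 1 and
    the terms of [mT] and [mV] make up [X k]. *)
Lemma pathser_solve k p : (p < k)%N ->
  pathser k p = e * (X k + u * \sum_(q < p) wt k q *: pathser k q).
Proof.
move=> pk; have := pathserE k p; rewrite /marks !big_cons big_nil.
rewrite /= addn1 !addn0 addr0.
have -> : \sum_(q < k | q == p :> nat) wt k q *: pathser k q = wt k p *: pathser k p.
  by rewrite (big_pred1 (Ordinal pk)).
have -> : \sum_(q < k | (q < p)%N) wt k q *: pathser k q =
    \sum_(q < p) wt k q *: pathser k q.
  by rewrite (big_ord_widen_cond k xpredT (fun q => wt k q *: pathser k q)) // ltnW.
rewrite -scalerAr scalerAl wt_w // => E.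
have uw : 1 - w \is a GRing.unit by apply: nc_unit1B.
apply: (canRL (mulKr uw)); rewrite mulrBl mul1r {1}E /X /T.
apply: (canLR (addrK _)); rewrite -!addrA; congr (_ + _).
by rewrite !addrA (ACl (4 * 2 * 1 * 3)).
Qed.

(** Passing from [p] to [p.+1] adds the weighted [u * pathser k p], which [pathser_solve] and the
    induction hypothesis turn into the new summand of [chain k p.+1], times [X k]. *)
Lemma pathser_chain k p : (p <= k)%N ->
  X k + u * (\sum_(q < p) wt k q *: pathser k q) = chain k p * X k.
Proof.
elim: p => [|p IH] pk; first by rewrite big_ord0 mulr0 addr0 mul1r.
rewrite big_ord_recr /= mulrDr addrA IH; last exact: ltnW.
rewrite pathser_solve // IH; last exact: ltnW.
by rewrite mulrDl -scalerAr -scalerAl !mulrA.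
Qed.

Lemma pathser_blockser k : T k = blockser k * X k.
Proof.
rewrite /T mulr_suml; apply: eq_bigr => p _.
rewrite pathser_solve // pathser_chain; last exact: ltnW.
by rewrite -scalerAl mulrA.
Qed.

(** [pathser_blockser] is a linear equation for [T k]. Solving it for [v * T k] first leaves
    [1 - v * blockser k] as the only element to invert. *)
Lemma blockser_step k :
  t * T k = t * (blockser k * (1 - v * blockser k)^-1) * (1 + t * T k.+1).
Proof.
have u1 g : 1 - v * g \is a GRing.unit by apply: nc_unit1B; apply: ord_geMr.
set g := blockser k.
have E : T k = g * (1 + t * T k.+1) + g * v * T k.
  by rewrite {1}pathser_blockser -/g /X mulrDr mulrA.
rewrite -!mulrA; congr (_ * _).
have F : v * T k = (1 - v * g)^-1 * (v * g * (1 + t * T k.+1)).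
  apply: (canRL (mulKr (u1 g))); rewrite mulrBl mul1r {1}E mulrDr !mulrA.
  by rewrite addrK.
rewrite E -mulrA F -mulrDr; congr (_ * _).
apply: (canRL (mulKr (u1 g))); rewrite mulrDr mulVKr // mulrBl mul1r.
by rewrite subrK.
Qed.

(** [blockser_step] is iterated from [k = 1]; the [k]-th factor is the stretch of a word from its
    [k]-th letter [mT] up to the next one. *)
Lemma ncsum_blockser p :
  ncsum [set n | (1 <= n)%N]%classic (fun n => pathgf n 0 p) =
  ncsum [set m | (1 <= m)%N]%classic (fun m =>
    \prod_(1 <= k < m.+1) (t * (blockser k * (1 - v * blockser k)^-1))).
Proof.
set h := fun k => t * (blockser k * (1 - v * blockser k)^-1).
(* As long as no label is available, only [mT] can be read, and the initial label [p] does not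
   constrain it. *)
have E0 : ncsum [set n | (1 <= n)%N]%classic (fun n => pathgf n 0 p) = t * T 1.
  apply: (addrI 1); rewrite ncsum_pathgf pathserE /marks !big_cons big_nil /=.
  by rewrite !big_ord0 !mulr0 !add0r addr0.
have prod_ord m : ord_ge (\prod_(1 <= k < m.+1) h k) m.
  elim: m => [|m IH]; first by [].
  rewrite big_nat_recr //= -[X in ord_ge _ X]addn1; apply: ord_geM => //.
  exact: ord_geMr.
(* The remainder after [m] steps has order at least [m.+1], so it disappears below any given
   length. *)
have E1 m : t * T 1 = \sum_(1 <= j < m.+1) \prod_(1 <= k < j.+1) h k +
    \prod_(1 <= k < m.+1) h k * (t * T m.+1).
  elim: m => [|m IH]; first by rewrite !big_geq // add0r mul1r.
  rewrite IH [in RHS]big_nat_recr //= -addrA; congr (_ + _).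
  rewrite [in RHS]big_nat_recr //= blockser_step -/(h m.+1).
  by rewrite mulrDr mulr1 mulrDr !mulrA.
rewrite E0; apply: eqm_eq => -[//|N].
apply: eqm_trans; last first.
  exact/eqm_sym/eqm_ncsum.
rewrite (E1 N) -[X in eqm _ _ X]addr0; apply: eqmD => // x xN.
have : ord_ge (\prod_(1 <= k < N.+1) h k * (t * T N.+1)) (N + 1).
  by apply: ord_geM => //; apply: ord_geMr.
by apply; rewrite addn1.
Qed.

End Series.

(** * Closed form of the series of a block *)

Definition wt_last (K : comNzRingType) (s : K) (k q : nat) : K :=
  if q.+1 == k then s else 1.
Definition wt_first (K : comNzRingType) (s : K) (k q : nat) : K :=
  if q == 0%N then s else 1.

Section ClosedForm.
Variables (A : eqType) (K : comNzRingType) (s : K) (lt : mark -> ncps A K).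

Local Notation u := (lt mU).
Local Notation w := (lt mW).
Local Notation e := (1 - w)^-1.
Local Notation a := (1 + u * e).

(** The last label, of weight [s], can only head the decreasing sequence; every smaller label
    contributes a factor [a] to [chain]. *)
Lemma blockser_last k :
  blockser (wt_last s) lt k.+1 = e * (\sum_(p < k) a ^+ p + s *: a ^+ k).
Proof.
have chainE p : (p <= k)%N -> chain (wt_last s) lt k.+1 p = a ^+ p.
  elim: p => [//|p IH] pk /=; rewrite IH 1?ltnW // /wt_last ltn_eqF ?ltnS //.
  by rewrite scale1r exprS mulrDl mul1r.
rewrite /blockser big_ord_recr /= /wt_last eqxx chainE // mulrDr mulr_sumr.
rewrite scalerAr; congr (_ + _); apply: eq_bigr => p _.
by rewrite chainE 1?ltnW // ltn_eqF ?ltnS // scale1r.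
Qed.

(** The label of weight [s] is now the smallest one, which is either the free label or the end of
    the chain. As [u * e] times the geometric sum is [a ^+ k - 1], the value is the same as for the
    last label. *)
Lemma blockser_first k :
  blockser (wt_first s) lt k.+1 = e * (\sum_(p < k) a ^+ p + s *: a ^+ k).
Proof.
have chainE p : chain (wt_first s) lt k.+1 p.+1 = a ^+ p + s *: (u * e * a ^+ p).
  elim: p => [|p IH]; first by rewrite /= /wt_first eqxx !mulr1.
  have -> : chain (wt_first s) lt k.+1 p.+2 = a * chain (wt_first s) lt k.+1 p.+1.
    by rewrite [LHS]/= {2}/wt_first /= scale1r [in RHS]mulrDl mul1r.
  have ab : a * (u * e) = u * e * a by rewrite mulrDl mulrDr mul1r mulr1.
  rewrite IH mulrDr -scalerAr [a * (u * e * _)]mulrA ab -[u * e * a * _]mulrA.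
  by rewrite -exprS; exact: erefl.
rewrite /blockser big_ord_recl [chain _ _ _ _]/= {1}/wt_first eqxx mulr1.
rewrite -[X in s *: X]mulr1 scalerAr.
have -> : \sum_(i < k) wt_first s k.+1 (bump 0 i) *:
      (e * chain (wt_first s) lt k.+1 (bump 0 i)) =
    \sum_(p < k) e * (a ^+ p + s *: (u * e * a ^+ p)).
  by apply: eq_bigr => p _; rewrite scale1r chainE.
rewrite -mulr_sumr -mulrDr big_split /= -scaler_sumr -mulr_sumr.
have -> : u * e * \sum_(p < k) a ^+ p = a ^+ k - 1.
  by rewrite subrX1 [a - 1]addrAC subrr add0r.
by rewrite addrCA -scalerDr [1 + (_ - _)]addrC subrK.
Qed.

(** The geometric sum of [blockser_last] telescopes because [a - 1 = u * e]. The right-hand side is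
    what the closed formulas divide by [u]. *)
Lemma mulr_blockser_last k :
  u * blockser (wt_last s) lt k.+1 = a ^+ k * (1 + s *: (u * e)) - 1.
Proof.
rewrite blockser_last mulrA mulrDr -scalerAr.
have ->: u * e * \sum_(p < k) a ^+ p = a ^+ k - 1.
  by rewrite subrX1 [a - 1]addrAC subrr add0r.
have -> : u * e * a ^+ k = a ^+ k * (u * e).
  apply: commrX; apply: commrD; first exact: commr1.
  exact: commr_refl.
by rewrite mulrDr mulr1 -scalerAr addrAC.
Qed.

End ClosedForm.

Lemma blockser_firstE (A : eqType) (K : comNzRingType) (s : K)
    (lt : mark -> ncps A K) k : (0 < k)%N ->
  blockser (wt_first s) lt k = blockser (wt_last s) lt k.
Proof. by case: k => // k _; rewrite blockser_first blockser_last. Qed.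

(** * Words in the four marks and comparison of weights *)

Section Words.
Variables (A : eqType) (K : comNzRingType).

Fixpoint words n : seq (seq mark) :=
  if n is n'.+1 then [seq c :: x | c <- marks, x <- words n'] else [:: [::]].

Lemma big_words0 (V : zmodType) (F : seq mark -> V) :
  \sum_(x <- words 0) F x = F [::].
Proof. by rewrite /= big_seq1. Qed.

Lemma big_wordsS (V : zmodType) n (F : seq mark -> V) :
  \sum_(x <- words n.+1) F x = \sum_(c <- marks) \sum_(x <- words n) F (c :: x).
Proof.
rewrite -[words n.+1]/[seq c :: x | c <- marks, x <- words n].
exact: big_allpairs_dep.
Qed.

Lemma eq_big_words (V : zmodType) n (F G : seq mark -> V) :
  (forall x, size x = n -> F x = G x) ->
  \sum_(x <- words n) F x = \sum_(x <- words n) G x.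
Proof.
elim: n F G => [|n IH] F G FG; first by rewrite !big_words0 FG.
rewrite !big_wordsS; apply: eq_bigr => c _; apply: IH => x xn.
by apply: FG; rewrite /= xn.
Qed.

Fixpoint pathwt (wt : nat -> nat -> K) (x : seq mark) (k p : nat) : K :=
  if x is c :: x' then
    \sum_(q < k + is_t c | step_ok c p q) wt (k + is_t c)%N q * pathwt wt x' (k + is_t c) q
  else 1.

Lemma pathgf_words wt (lt : mark -> ncps A K) n k p :
  pathgf wt lt n k p =
    \sum_(x <- words n) pathwt wt x k p *: \prod_(c <- x) lt c.
Proof.
elim: n k p => [|n IH] k p; first by rewrite big_words0 big_nil scale1r.
rewrite big_wordsS /=; apply: eq_bigr => c _.
under eq_bigr => q _ do rewrite IH scaler_sumr.
rewrite exchange_big mulr_sumr; apply: eq_bigr => x _ /=.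
rewrite big_cons scaler_suml mulr_sumr; apply: eq_bigr => q _.
by rewrite scalerA -scalerAr.
Qed.

Definition allowed n (al : nat -> mark -> bool) (x : seq mark) :=
  all (fun i => al i (nth mT x i)) (iota 0 n).

Lemma prod_allowed (lt : mark -> ncps A K) n (al : nat -> mark -> bool) :
  \prod_(i < n) \sum_(c <- marks | al i c) lt c =
    \sum_(x <- words n) (allowed n al x)%:R *: \prod_(c <- x) lt c.
Proof.
elim: n al => [|n IH] al.
  by rewrite big_ord0 big_words0 big_nil scale1r.
rewrite big_ord_recl (IH (fun i => al i.+1)) big_wordsS mulr_suml.
rewrite big_mkcond; apply: eq_bigr => c _.
have alE x : allowed n.+1 al (c :: x) = al 0 c && allowed n (fun i => al i.+1) x.
  by rewrite /allowed /= (iotaDl 1) all_map.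
case: ifP => alc; last first.
  by rewrite big1 // => x _; rewrite alE alc scale0r.
rewrite mulr_sumr; apply: eq_bigr => x _.
by rewrite alE alc big_cons -scalerAr.
Qed.

(** The product attached to each object is expanded into words, so that it suffices to compare
    weights one word at a time. Words containing [mW] are skipped when [lt mW = 0], the situation of
    the silly ascents. *)
Lemma sum_prod_allowed wt (lt : mark -> ncps A K) n (O : Type) (r : seq O)
    (a : O -> K) (al : O -> nat -> mark -> bool) :
  (forall x, size x = n -> all (fun c => ~~ is_w c) x || (lt mW != 0) ->
    \sum_(o <- r | allowed n (al o) x) a o = pathwt wt x 0 0) ->
  \sum_(o <- r) a o *: \prod_(i < n) \sum_(c <- marks | al o i c) lt c =
  pathgf wt lt n 0 0.
Proof.
move=> aE; rewrite pathgf_words.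
under eq_bigr => o _ do rewrite prod_allowed scaler_sumr.
rewrite exchange_big; apply: eq_big_words => x xn.
under eq_bigr => o _ do rewrite scalerA.
rewrite -scaler_suml.
have [xW|] := boolP (all (fun c => ~~ is_w c) x || (lt mW != 0)).
  rewrite -aE //; congr (_ *: _); rewrite [RHS]big_mkcond; apply: eq_bigr => o _.
  by case: ifP => _; rewrite ?mulr1 ?mulr0.
rewrite negb_or negbK => /andP[xW /eqP w0].
suff -> : \prod_(c <- x) lt c = 0 by rewrite !scaler0.
elim: x xW {xn} => //= c x IH; rewrite negb_and negbK big_cons.
by case: c => //= [||_|] ; rewrite ?w0 ?mul0r // => /IH ->; rewrite mulr0.
Qed.

Variables (wt : nat -> nat -> K) (om : nat -> mark).

Definition numT n := count (is_t \o om) (iota 0 n).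

Lemma numTS n : numT n.+1 = (numT n + is_t (om n))%N.
Proof. by rewrite /numT -[n.+1]addn1 iotaD count_cat /= addn0. Qed.

(** [W n G] stands for the weighted sum, over the objects of size [n], of [G] at the last label.
    Objects grow at their last letter, whereas [pathwt] reads a word from its first letter. *)
Lemma pathwt_transfer (W : nat -> (nat -> K) -> K) n :
    (forall G, W 0 G = G 0) ->
    (forall n G, W n.+1 G = W n (fun p =>
      \sum_(q < numT n.+1 | step_ok (om n) p q) wt (numT n.+1) q * G q)) ->
  W n (fun=> 1) = pathwt wt (mkseq om n) 0 0.
Proof.
move=> W0 WS.
(* Both readings meet at a cut: the first [i] letters are handled by [W], the next [m] by
   [pathwt]. *)
suff E m i : W (i + m)%N (fun=> 1) =
    W i (pathwt wt (mkseq (fun j => om (i + j)%N) m) (numT i)).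
  by rewrite -[n in LHS]add0n E W0.
elim: m i => [|m IH] i; first by rewrite addn0.
rewrite addnS -addSn IH WS; congr (W i _); apply: funext => p /=.
rewrite addn0 -numTS; apply: eq_bigr => q _; congr (_ * pathwt _ _ _ _).
rewrite /mkseq [in RHS](iotaDl 1) -map_comp.
by apply: eq_map => j /=; rewrite addSnnS.
Qed.

End Words.

(** * Permutations by insertion *)

Definition ins (x j : nat) (l : seq nat) := take j l ++ x :: drop j l.

(** Values are inserted in increasing order from [a] on: ascents use [a = 0], silly ascents [a = 1],
    which frees 0 for the virtual value. *)
Fixpoint perms a n : seq (seq nat) :=
  if n is n'.+1 then [seq ins (a + n') j l | l <- perms a n', j <- iota 0 n'.+1]
  else [:: [::]].

Lemma perm_ins x j l : perm_eql (ins x j l) (x :: l).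
Proof. by apply/permPl; rewrite /ins -cat1s perm_catCA cat_take_drop. Qed.

Lemma perm_iotaS a n : perm_eql (iota a n.+1) (a + n :: iota a n)%N.
Proof. by apply/permPl; rewrite -addn1 iotaD perm_catC. Qed.

Lemma mem_perms a n l : (l \in perms a n) = perm_eq l (iota a n).
Proof.
apply/idP/idP.
  elim: n l => [|n IH] l; first by rewrite inE => /eqP ->.
  case/allpairsPdep => l' [j [/IH l'P _ ->]].
  by rewrite perm_ins perm_sym perm_iotaS perm_cons perm_sym.
elim: n l => [|n IH] l lP; first by rewrite inE (perm_small_eq _ lP).
have al : (a + n)%N \in l by rewrite (perm_mem lP) mem_iota; lia.
case/splitPr: l / al lP => p1 p2 lP.
apply/allpairsPdep; exists (p1 ++ p2), (size p1); split.
- apply: IH; move: lP; rewrite perm_sym perm_iotaS perm_sym.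
  by rewrite -cat1s perm_catCA perm_cons.
- rewrite mem_iota; have /perm_size := lP; rewrite size_cat /= size_iota; lia.
- by rewrite /ins take_size_cat // drop_size_cat.
Qed.

Lemma size_perms a n : size (perms a n) = n`!.
Proof.
elim: n => [//|n IH]; rewrite factS -IH mulnC.
by rewrite [LHS]size_allpairs size_iota.
Qed.

Lemma big_permsS (V : zmodType) a n (F : seq nat -> V) :
  \sum_(l <- perms a n.+1) F l =
  \sum_(l <- perms a n) \sum_(j < n.+1) F (ins (a + n) j l).
Proof.
rewrite -[perms a n.+1]/[seq ins (a + n) j l | l <- perms a n, j <- iota 0 n.+1].
rewrite big_allpairs_dep; apply: eq_bigr => l _.
by rewrite -[iota 0 n.+1]/(index_iota 0 n.+1) big_mkord.
Qed.

Definition plist a n (p : 'S_n) : seq nat := [seq (a + p j)%N | j <- enum 'I_n].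

Lemma plist_perm a n (p : 'S_n) : perm_eq (plist a p) (iota a n).
Proof.
apply: uniq_perm; rewrite ?iota_uniq // /plist.
  rewrite map_inj_uniq ?enum_uniq // => i j /addnI /val_inj.
  exact: perm_inj.
move=> x; rewrite mem_iota; apply/mapP/idP => [[j _ ->]|xP].
  by have := ltn_ord (p j); lia.
have xa : (x - a < n)%N by lia.
exists ((p^-1)%g (Ordinal xa)); rewrite ?mem_enum // permKV /=; lia.
Qed.

(** [plist a] is an injection into a list whose size is the number of permutations; this also shows
    that [perms a n] has no repetition. *)
Lemma big_perms (V : zmodType) a n (F : seq nat -> V) :
  \sum_(p : 'S_n) F (plist a p) = \sum_(l <- perms a n) F l.
Proof.
have plist_inj : injective (@plist a n).
  move=> p q pq; apply/permP => j; apply/val_inj/(@addnI a).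
  by move/eq_in_map: pq; apply; rewrite mem_enum.
have plistP : {subset [seq plist a p | p : 'S_n] <= perms a n}.
  by move=> l /mapP[p _ ->]; rewrite mem_perms plist_perm.
have plist_uniq : uniq [seq plist a p | p : 'S_n].
  by rewrite map_inj_uniq ?enum_uniq.
have [|_ plist_mem] := uniq_min_size plist_uniq plistP.
  by rewrite size_perms size_map -cardE card_Sn.
have permsU : uniq (perms a n).
  apply: leq_size_uniq plist_uniq plistP _.
  by rewrite size_perms size_map -cardE card_Sn.
rewrite -(perm_big _ (uniq_perm plist_uniq permsU plist_mem)) /=.
by rewrite big_map big_enum.
Qed.

(** * Gaps of a list and the insertion of a new greatest value *)

Section Gaps.
Variable T : pred nat.
Implicit Types (l : seq nat) (i j : nat).

(** A new element inserted at the position [j] does not come just before an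
    element out of [T]. *)
Definition gap l j := if drop j l is y :: _ then T y else true.

(** There is one gap before each element of [T] and one at the end, so the number of elements of [T]
    on the left numbers the gaps from 0 to [count T l]. *)
Lemma sum_gaps (V : zmodType) l (F : nat -> V) :
  \sum_(j < (size l).+1 | gap l j) F (count T (take j l)) =
  \sum_(q < (count T l).+1) F q.
Proof.
elim: l F => [|x l IH] F.
  by rewrite big_mkcond !big_ord1.
have := IH (fun q => F (T x + q)%N); rewrite big_mkcond => {}IH.
rewrite big_mkcond big_ord_recl /= -[X in _ + X]/(\sum_(j < (size l).+1)
  if gap l j then F (T x + count T (take j l))%N else 0) IH /gap /=.
case: (T x) => /=; last by rewrite add0r.
by rewrite [RHS]big_ord_recl.
Qed.

Lemma count_take_mono l i j : (i <= j)%N ->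
  (count T (take i l) <= count T (take j l))%N.
Proof.
move=> ij; rewrite -(subnKC ij) takeD count_cat; lia.
Qed.

Lemma count_take_gap l i j : gap l j -> (j < i)%N -> (j < size l)%N ->
  (count T (take j l) < count T (take i l))%N.
Proof.
rewrite /gap => gj ji jl; apply: leq_trans (count_take_mono l ji).
rewrite (take_nth 0 jl) -cats1 count_cat /= addn0.
by rewrite (drop_nth 0 jl) in gj; rewrite gj addn1.
Qed.

Lemma gap_end l j : gap l j -> (j <= size l)%N ->
  (count T (take j l) == count T l) = (j == size l).
Proof.
move=> gj; rewrite leq_eqVlt => /predU1P[->|jl]; first by rewrite take_size !eqxx.
have := count_take_gap gj jl jl; rewrite take_size => lt_c.
by rewrite !ltn_eqF.
Qed.

(** The hypotheses say that [x] may precede [y] exactly when [T y], and that such a [y] may follow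
    anything; hence the link broken by an insertion in a gap carried no condition. *)
Lemma path_ins (r : rel nat) x0 x l j :
    {in l, forall y, r x y = T y} -> {in l, forall y, T y -> forall z, r z y} ->
  path r x0 (ins x j l) = [&& path r x0 l, r (last x0 (take j l)) x & gap l j].
Proof.
move=> rx rT; rewrite -{2}(cat_take_drop j l) /ins !cat_path /= /gap.
have := @mem_drop j nat l.
case: (drop j l) => [|y l'] yl /=; first by rewrite !andbT.
rewrite rx ?yl ?mem_head //.
case: (boolP (T y)) => Ty; last by rewrite !andbF.
have /(_ Ty) ry := rT y (yl y (mem_head _ _)).
by rewrite !ry !andbT; case: (path r x0 _) => //=; rewrite andbC.
Qed.

End Gaps.

Lemma index_ins x j l y : x \notin l -> y \in l -> (j <= size l)%N ->
  index y (ins x j l) = (index y l + (j <= index y l))%N.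
Proof.
move=> xl yl jl; rewrite /ins index_cat /=.
have -> : index y l = if y \in take j l then index y (take j l)
    else (size (take j l) + index y (drop j l))%N.
  by rewrite -{1}(cat_take_drop j l) index_cat.
have xy : (x == y) = false by apply: contraNF xl => /eqP ->.
have szt : size (take j l) = j by rewrite size_takel.
case: ifP => yt; last by rewrite xy szt leq_addr addn1 addnS.
have := index_mem y (take j l).
by rewrite yt szt ltnNge; case: leqP => // _; rewrite addn0.
Qed.

Lemma index_ins_new x j l : x \notin l -> (j <= size l)%N -> index x (ins x j l) = j.
Proof.
move=> xl jl; rewrite /ins index_cat ifN /= ?eqxx ?addn0 ?size_takel //.
by apply: contra xl; apply: mem_take.
Qed.

Fixpoint rminl (l : seq nat) : nat :=
  (if l is x :: l' then all (ltn x) l' + rminl l' else 0)%N.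

(** A new greatest value spoils no right-to-left minimum, and is one only at the right end. *)
Lemma rminl_ins x j l : all (gtn x) l -> (j <= size l)%N ->
  rminl (ins x j l) = (rminl l + (j == size l))%N.
Proof.
elim: l j => [|y l IH] [|j] //=.
  by case/andP=> yx _ _; rewrite /ins /= ltnNge ltnW //= addn0.
case/andP=> yx lx jl; rewrite /ins /= -/(ins x j l) IH // eqSS addnA.
by rewrite all_cat /= (yx : (y < x)%N) /= -all_cat cat_take_drop.
Qed.

(** * Ascents: compatible permutations as labelled words *)

Section PermutationPaths.
Variables (K : comNzRingType) (s : K) (om : nat -> mark).
Implicit Types (l : seq nat).

Local Notation T := (is_t \o om).

(** The relation required between consecutive values [a], [b]; the sentinel
    [n] in front of a permutation of [0, ..., n - 1] makes its head fail all of
    the constraints but [mT]. *)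
Definition asc_rel (a b : nat) : bool :=
  match om b with mT => true | mW => a.+1 == b | _ => (a < b)%N end.

Definition asc_compat n l :=
  path asc_rel n l &&
  all (fun i => is_u (om i) ==> (index i l < index i.-1 l)%N) (iota 0 n).

(** The rank, from 0 on, of the block containing the last inserted value, blocks being cut in front
    of the values in [T]. *)
Definition asc_label n l := (count T (take (index n.-1 l).+1 l)).-1.

Definition asc_sum n (G : nat -> K) :=
  \sum_(l <- perms 0 n | asc_compat n l) s ^+ rminl l * G (asc_label n l).

Lemma asc_rel_gt n y : (y < n)%N -> asc_rel n y = T y.
Proof. rewrite /asc_rel /=; case: (om y) => //= yn; lia. Qed.

Lemma asc_relT y : T y -> forall z, asc_rel z y.
Proof. by rewrite /asc_rel /=; case: (om y). Qed.

Lemma count_perms a n l : l \in perms a n -> count T l = count T (iota a n).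
Proof. by rewrite mem_perms => /seq.permP ->. Qed.

Lemma asc_rel_lt a b : is_u (om b) -> asc_rel a b = (a < b)%N.
Proof. by rewrite /asc_rel; case: (om b). Qed.

Section Insertion.
Variables (n : nat) (l : seq nat).
Hypothesis lP : l \in perms 0 n.

Let lperm : perm_eq l (iota 0 n). Proof. by rewrite -mem_perms. Qed.
Let szl : size l = n. Proof. by rewrite (perm_size lperm) size_iota. Qed.
Let meml y : (y \in l) = (y < n)%N. Proof. by rewrite (perm_mem lperm) mem_iota. Qed.
Let nl : n \notin l. Proof. by rewrite meml ltnn. Qed.

Let path_sentinel : path asc_rel n.+1 l = path asc_rel n l.
Proof.
have : {in l, forall y, (y < n)%N} by move=> y; rewrite meml.
case: l => [|x l'] //= ln; have := ln x (mem_head _ _) => xn.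
by rewrite !asc_rel_gt // ltnW.
Qed.

Lemma asc_compat_ins j : (j <= n)%N ->
  asc_compat n.+1 (ins n j l) = [&& asc_compat n l, gap T l j,
    asc_rel (last n.+1 (take j l)) n & is_u (om n) ==> (j <= index n.-1 l)%N].
Proof.
move=> jn; have jl : (j <= size l)%N by rewrite szl.
rewrite /asc_compat (path_ins (T := T)); first last.
- by move=> y _; apply: asc_relT.
- by move=> y; rewrite meml; apply: asc_rel_gt.
rewrite path_sentinel -addn1 iotaD all_cat /= add0n addn1 andbT.
have -> : all (fun i => is_u (om i) ==> (index i (ins n j l) < index i.-1 (ins n j l))%N)
     (iota 0 n) =
   all (fun i => is_u (om i) ==> (index i l < index i.-1 l)%N) (iota 0 n).
  apply: eq_in_all => i; rewrite mem_iota /= => ii; congr (_ ==> _).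
  rewrite !index_ins ?meml ?ltnn //; last by lia.
  case: (leqP j (index i l)); case: (leqP j (index i.-1 l)); lia.
rewrite index_ins_new //.
(* For [n = 0] the index [n.-1] is [n] itself, so the position condition refuses [mU]; on the
   right-hand side the sentinel refuses it. *)
have [n0|n_gt0] := posnP n.
  have -> : (j < index n.-1 (ins n j l))%N = false.
    by rewrite (_ : n.-1 = n) ?index_ins_new ?ltnn // n0.
  have l0 : l = [::] by apply: size0nil; rewrite szl.
  rewrite l0 /=; case: (boolP (is_u (om n))) => [/(asc_rel_lt n.+1) ->|_].
    by rewrite ltnNge leqnSn !andbF.
  by rewrite !implyFb !andbT; case: (all _ _); rewrite ?andbF ?andbT.
rewrite index_ins ?meml ?ltnn //; last by lia.
have -> : (j < index n.-1 l + (j <= index n.-1 l))%N = (j <= index n.-1 l)%N.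
  by case: (leqP j (index n.-1 l)); lia.
case: (path _ _ l); case: (all _ _); rewrite //= ?andbF //=.
by case: (gap _ _ _); case: (asc_rel _ _).
Qed.

Hypothesis lc : asc_compat n l.

Let path_l : path asc_rel n l. Proof. by case/andP: lc. Qed.

Let head_t : (0 < n)%N -> exists x, exists2 l', l = x :: l' & is_t (om x).
Proof.
case: l path_l szl meml => [|x l'] /=; first by move=> _ <-.
move=> /andP[nx _] _ meml' _; exists x, l' => //.
by move: nx; rewrite asc_rel_gt // -meml' mem_head.
Qed.

Let count_gt0 j : (j <= n)%N -> (0 < count T (take j l))%N = (0 < j)%N.
Proof.
case: j => [|j] jn; first by rewrite take0.
by have [|x [l' -> /= ->]] := head_t; first by lia.
Qed.

(** [q] counts the blocks to the left of the insertion. A value in [T] opens a new block of rank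
    [q]; any other value is put at the end of the block of rank [q.-1], which has to exist. *)
Let step_c (c : mark) (q p : nat) :=
  match c with mT => true | mV => (0 < q)%N | mU => (0 < q)%N && (q.-1 < p)%N
  | mW => (0 < q)%N && (q.-1 == p) end.

(** The number of elements of [T] on the left increases strictly past a gap, so comparing positions
    amounts to comparing ranks of blocks. *)
Lemma asc_gap_label j : (j <= n)%N -> gap T l j ->
  asc_rel (last n.+1 (take j l)) n && (is_u (om n) ==> (j <= index n.-1 l)%N) =
  step_c (om n) (count T (take j l)) (asc_label n l).
Proof.
move=> jn gj; have c0 := count_gt0 jn.
have lastE : (last n.+1 (take j l) < n)%N = (0 < j)%N.
  case: j jn {gj c0} => [|j] jn; first by rewrite take0 /=; lia.
  have [|x [l' lE _]] := head_t; first by lia.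
  rewrite lE /= -meml lE.
  have := mem_last x (take j l'); rewrite !inE => /predU1P[->|/mem_take ->].
    by rewrite eqxx.
  by rewrite orbT.
set i := index n.-1 l.
have ij : (0 < n)%N -> (i < n)%N.
  by move=> n0; rewrite -[X in (_ < X)%N]szl index_mem meml; lia.
have pE : (0 < n)%N -> (asc_label n l).+1 = count T (take i.+1 l).
  by move=> n0; rewrite /asc_label prednK // count_gt0 ?ij.
have lo : (j <= i)%N -> (0 < n)%N -> (count T (take j l) < count T (take i.+1 l))%N.
  by move=> ji n0; apply: count_take_gap => //; rewrite ?ltnS // szl (leq_ltn_trans ji) ?ij.
have hi : (i < j)%N -> (count T (take i.+1 l) <= count T (take j l))%N.
  exact: count_take_mono.
rewrite /asc_rel; case E: (om n) => /=; rewrite ?andbT ?lastE ?c0 //.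
- case: (posnP j) => //= j0; have n0 : (0 < n)%N by lia.
  have := pE n0; have := lo^~ n0; move: c0; rewrite j0; case: leqP; lia.
- case: (posnP j) => //= [j0|j0].
    by rewrite j0 take0 /=; lia.
  have n0 : (0 < n)%N by lia.
  have nthi : nth 0%N l i = n.-1 by rewrite nth_index // meml; lia.
  have lastj : last n.+1 (take j l) = nth 0%N l j.-1.
    by rewrite (last_nth 0%N) size_takel ?szl // -(prednK j0) /= nth_take.
  (* Only a letter [mT] can follow the greatest value [n.-1], so the position just after it is a
     gap, and later gaps have a larger rank. *)
  have gi : (i.+1 < j)%N -> gap T l i.+1.
    move=> ij1; have i1l : (i.+1 < size l)%N by rewrite szl; lia.
    have := pathP 0%N path_l i.+1 i1l; rewrite /= nthi /gap (drop_nth 0%N i1l).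
    have : nth 0%N l i.+1 \in l by rewrite mem_nth.
    rewrite meml /asc_rel /=; case: (om _) => //=; lia.
  have hi2 : (i.+1 < j)%N -> (count T (take i.+1 l) < count T (take j l))%N.
    by move=> ij1; apply: count_take_gap => //; [exact: gi|rewrite szl; lia].
  have -> : ((last n.+1 (take j l)).+1 == n) = (j.-1 == i).
    rewrite lastj -[j.-1 == i](nth_uniq 0%N (s := l)) ?nthi.
    - by apply/eqP/eqP => [<- //|->]; rewrite prednK.
    - by rewrite szl; lia.
    - by rewrite szl ij.
    - by rewrite (perm_uniq lperm) iota_uniq.
  have := pE n0; have := lo^~ n0; move: c0; rewrite j0.
  case: (ltngtP j i.+1) => [||jE]; [|have := hi2|rewrite jE]; lia.
Qed.

Lemma asc_label_ins j : (j <= n)%N ->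
  asc_label n.+1 (ins n j l) = (count T (take j l) + is_t (om n)).-1.
Proof.
move=> jn; rewrite /asc_label /= index_ins_new ?szl // /ins.
rewrite take_cat size_takel ?szl // ltnNge leqnSn /= subSnn /= take0.
by rewrite count_cat /= addn0.
Qed.

Lemma asc_sum_ins (G : nat -> K) :
  \sum_(j < n.+1 | asc_compat n.+1 (ins n j l))
     s ^+ rminl (ins n j l) * G (asc_label n.+1 (ins n j l)) =
  s ^+ rminl l * \sum_(q < numT om n.+1 | step_ok (om n) (asc_label n l) q)
                    wt_last s (numT om n.+1) q * G q.
Proof.
(* The exponent of [s] is 1 exactly for the gap at the end, the only one with all of [T] on its
   left. *)
pose F q := if step_c (om n) q (asc_label n l) then
  s ^+ (q == count T l) * G (q + is_t (om n)).-1 else 0.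
transitivity (s ^+ rminl l * \sum_(j < (size l).+1 | gap T l j) F (count T (take j l))).
  rewrite szl mulr_sumr [LHS]big_mkcond [RHS]big_mkcond; apply: eq_bigr => j _.
  have jn : (j <= n)%N by rewrite -ltnS.
  rewrite asc_compat_ins // lc /=; case: (boolP (gap T l j)) => //= gj.
  rewrite asc_gap_label // /F; case: ifP => _; last by rewrite mulr0.
  rewrite asc_label_ins // rminl_ins ?szl //; last first.
    by apply/allP => y; rewrite meml.
  by rewrite gap_end ?szl // exprD mulrA.
have numE : numT om n = count T l by rewrite (count_perms lP).
rewrite sum_gaps; congr (_ * _); rewrite numTS numE.
rewrite /F /wt_last.
case: (om n) => /=; rewrite ?addn0 ?addn1; last first.
  apply: eq_bigr => q _; rewrite eqSS addn1; congr (_ * _).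
  by case: eqP => _; rewrite ?expr1 ?expr0.
(* For the letters other than [mT], [q = 0] is refused and the label is [q.-1], so the sum is
   shifted by one. *)
all: rewrite big_ord_recl add0r [RHS]big_mkcond; apply: eq_bigr => q _ /=.
all: rewrite /bump /= add1n addn0 /=; case: ifP => // _; congr (_ * _).
all: by case: eqP => _; rewrite ?expr1 ?expr0.
Qed.

End Insertion.

Lemma asc_sum0 G : asc_sum 0 G = G 0%N.
Proof. by rewrite /asc_sum big_mkcond big_seq1 /= mul1r. Qed.

Lemma asc_sumS n G : asc_sum n.+1 G = asc_sum n (fun p =>
  \sum_(q < numT om n.+1 | step_ok (om n) p q) wt_last s (numT om n.+1) q * G q).
Proof.
rewrite /asc_sum [LHS]big_mkcond big_permsS [RHS]big_mkcond /=.
rewrite [LHS]big_seq [RHS]big_seq; apply: eq_bigr => l lP.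
rewrite -big_mkcond add0n; case: ifP => lc; first exact: asc_sum_ins.
by rewrite big1 // => j; rewrite asc_compat_ins // ?lc // -ltnS.
Qed.

Lemma asc_sum_pathwt n :
  \sum_(l <- perms 0 n | asc_compat n l) s ^+ rminl l =
  pathwt (wt_last s) (mkseq om n) 0 0.
Proof.
rewrite -(pathwt_transfer (W := asc_sum) _ asc_sum0 asc_sumS).
by apply: eq_bigr => l _; rewrite mulr1.
Qed.

End PermutationPaths.

(** * From permutations to lists, and the bracket of the ascents *)

Lemma nth_plist a n (p : 'S_n) (j : 'I_n) : nth 0%N (plist a p) j = (a + p j)%N.
Proof. by rewrite (nth_map j) ?size_enum_ord // nth_ord_enum. Qed.

Lemma index_plist a n (p : 'S_n) (j : 'I_n) : index (a + p j)%N (plist a p) = j.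
Proof.
have finj : injective (fun j : 'I_n => (a + p j)%N).
  by move=> i k /addnI /val_inj; apply: perm_inj.
by rewrite -[RHS]index_enum_ord -(index_map finj).
Qed.

Lemma size_plist a n (p : 'S_n) : size (plist a p) = n.
Proof. by rewrite size_map size_enum_ord. Qed.

Lemma rminl_plist a n (p : 'S_n) : rminl (plist a p) = rmin p.
Proof.
have rminlE l : rminl l = (\sum_(j < size l) all (ltn (nth 0 l j)) (drop j.+1 l))%N.
  elim: l => [|x l IH]; first by rewrite big_ord0.
  by rewrite big_ord_recl /= drop0 IH.
rewrite rminlE /rmin card_imset; last exact: perm_inj.
rewrite size_plist -sum1_card [RHS]big_mkcond; apply: eq_bigr => j _.
rewrite inE nth_plist; congr (nat_of_bool _).
have szd : size (drop j.+1 (plist a p)) = (n - j.+1)%N by rewrite size_drop size_plist.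
apply/(all_nthP 0%N)/forallP => [lP k|kP i].
  apply/implyP => jk; have := lP (k - j.+1)%N; rewrite szd nth_drop subnKC //.
  by rewrite nth_plist /= ltn_add2l; apply; have := ltn_ord k; lia.
rewrite szd => ilt; have kn : (j.+1 + i < n)%N by lia.
rewrite nth_drop -[(j.+1 + i)%N]/(val (Ordinal kn)) nth_plist /= ltn_add2l.
by have /implyP := kP (Ordinal kn); apply => /=; lia.
Qed.

Lemma path_perm_iota (r : rel nat) x0 l a n : perm_eq l (iota a n) ->
  path r x0 l = all (fun i => r (nth 0%N (x0 :: l) (index i l)) i) (iota a n).
Proof.
move=> lP; rewrite -(perm_all _ lP).
apply/(pathP 0%N)/(all_nthP 0%N) => H i il; have := H i il.
  by rewrite index_uniq // (perm_uniq lP) iota_uniq.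
by rewrite index_uniq // (perm_uniq lP) iota_uniq.
Qed.

Section PermutationBracket.
Variables (A : eqType) (K : comNzRingType) (s : K) (lt : mark -> ncps A K).

Definition asc_in (l : seq nat) i :=
  (0 < index i l)%N && (nth 0 l (index i l).-1 < i)%N.

(** The marks whose series are summed in the factor [i]: [u + v + t] on [Pasc], [v + t] on [Qasc],
    [v + w + t] on [Asc_short] and [t] elsewhere. *)
Definition asc_allowed (l : seq nat) i c :=
  match c with
  | mT => true
  | mV => asc_in l i
  | mU => asc_in l i && (index i l < index i.-1 l)%N
  | mW => (0 < index i l)%N && ((nth 0 l (index i l).-1).+1 == i)
  end.

Lemma asc_allowedE n l x : perm_eq l (iota 0 n) ->
  allowed n (asc_allowed l) x = asc_compat (nth mT x) n l.
Proof.
move=> lP; rewrite /asc_compat (path_perm_iota _ _ lP) -all_predI.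
apply: eq_in_all => i; rewrite mem_iota /= => ilt.
(* At position 0 the left neighbour is the sentinel [n], which exceeds [i], so that only [mT]
   passes. *)
have ni : (n < i)%N = false by lia.
have ni1 : (n.+1 == i) = false by lia.
rewrite /asc_rel; case: (nth mT x i) => //=; rewrite /asc_in ?andbT.
all: case: (index i l) => [|j] //=; rewrite ?ni ?ni1 //.
Qed.

Section Sets.
Variables (n : nat) (p : 'S_n).
Local Notation l := (plist 0 p).

Let idx (j : 'I_n) : index (p j : nat) l = j. Proof. exact: (index_plist 0). Qed.
Let val_l (j : 'I_n) : nth 0%N l j = p j. Proof. exact: (nth_plist 0). Qed.

Let asc_inP (j : 'I_n) : reflect (exists i0, ascent_at p i0 j) (asc_in l (p j)).
Proof.
rewrite /asc_in idx; apply: (iffP andP) => [[j0 lt_p]|[i0 /andP[/eqP ji pij]]].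
  have j1 : (j.-1 < n)%N by have := ltn_ord j; lia.
  exists (Ordinal j1); rewrite /ascent_at /= prednK // eqxx /=.
  by rewrite -[j.-1]/(val (Ordinal j1)) val_l in lt_p.
by rewrite ji /= val_l.
Qed.

Let predP (j : 'I_n) : (0 < p j)%N -> exists2 k, p j = (p k).+1 :> nat &
  index (p j).-1 l = k.
Proof.
move=> pj; have pk : ((p j).-1 < n)%N by have := ltn_ord (p j); lia.
exists ((p^-1)%g (Ordinal pk)); rewrite ?permKV /= ?prednK //.
by rewrite -[RHS]idx permKV.
Qed.

Let asc_gt0 j : asc_in l (p j) -> (0 < p j)%N.
Proof. by case/andP => _; apply: leq_ltn_trans. Qed.

Lemma mem_Pasc (i : 'I_n) : (i \in Pasc p) = asc_allowed l i mU.
Proof.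
have [j ->] : exists j, i = p j by exists ((p^-1)%g i); rewrite permKV.
rewrite inE /= idx; apply/idP/idP.
  case/existsP => i0 /existsP[j' /existsP[k]].
  case/and4P => asc /eqP/perm_inj jj /eqP pjk jk; subst j'.
  rewrite (introT (asc_inP _)) /=; last by exists i0.
  by rewrite pjk idx.
case/andP => asc; have [k pjk ->] := predP (asc_gt0 asc) => jk.
have /asc_inP[i0 asc0] := asc.
apply/existsP; exists i0; apply/existsP; exists j; apply/existsP; exists k.
by rewrite asc0 eqxx pjk eqxx.
Qed.

Lemma mem_Qasc (i : 'I_n) :
  (i \in Qasc p) = asc_in l i && (index i.-1 l < (index (i : nat) l).-1)%N.
Proof.
have [j ->] : exists j, i = p j by exists ((p^-1)%g i); rewrite permKV.
rewrite inE /= idx; apply/idP/idP.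
  case/existsP => i0 /existsP[j' /existsP[k]].
  case/and4P => asc /eqP/perm_inj jj /eqP pjk jk; subst j'.
  rewrite (introT (asc_inP _)) /=; last by exists i0.
  by rewrite pjk idx; case/andP: asc => /eqP ->.
case/andP => asc; have [k pjk ->] := predP (asc_gt0 asc) => jk.
have /asc_inP[i0 asc0] := asc.
apply/existsP; exists i0; apply/existsP; exists j; apply/existsP; exists k.
by rewrite asc0 eqxx pjk eqxx; case/andP: asc0 jk => /eqP ->.
Qed.

Lemma mem_Asc_short (i : 'I_n) : (i \in Asc_short p) = asc_allowed l i mW.
Proof.
have [j ->] : exists j, i = p j by exists ((p^-1)%g i); rewrite permKV.
rewrite inE /= idx; apply/idP/idP.
  case/existsP => i0 /existsP[j' /and3P[/andP[/eqP ji asc] /eqP/perm_inj jj pjk]].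
  by rewrite jj ji /= val_l eq_sym.
case/andP => j0 lE; have j1 : (j.-1 < n)%N by have := ltn_ord j; lia.
rewrite -[j.-1]/(val (Ordinal j1)) val_l in lE.
apply/existsP; exists (Ordinal j1); apply/existsP; exists j.
by rewrite /ascent_at /= prednK // -(eqP lE) !eqxx /= ltnS leqnn.
Qed.

(** The value just below an ascent lies to its right, or is its left neighbour, or lies further
    left. *)
Lemma asc_trichotomy (i : 'I_n) :
  asc_in l i = [|| i \in Pasc p, i \in Qasc p | i \in Asc_short p].
Proof.
rewrite mem_Pasc mem_Qasc mem_Asc_short /=.
have [j ->] : exists j, i = p j by exists ((p^-1)%g i); rewrite permKV.
apply/idP/idP => [asc|].
  rewrite asc /=; have [k pjk ->] := predP (asc_gt0 asc); rewrite idx.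
  case/andP: asc; rewrite idx => j0 lt_p; rewrite j0 /=.
  have kj : k <> j :> nat by move/val_inj => kj; rewrite kj in pjk; lia.
  case: (ltngtP j k) => [//|kltj|jk]; last by case: kj.
  have [//|jk] := ltnP k j.-1; have -> : j.-1 = k by lia.
  by rewrite /= val_l pjk.
case/or3P => [/andP[]|/andP[]|/andP[j0 /eqP lE]] //.
by rewrite /asc_in j0 /= -[X in (_ < X)%N]lE.
Qed.

Lemma Asc_short_Pasc (i : 'I_n) : i \in Asc_short p -> i \notin Pasc p /\ i \notin Qasc p.
Proof.
have [j ->] : exists j, i = p j by exists ((p^-1)%g i); rewrite permKV.
rewrite mem_Asc_short mem_Pasc mem_Qasc /= idx => /andP[j0 /eqP lE].
rewrite -lE /=; have j1 : (j.-1 < n)%N by have := ltn_ord j; lia.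
rewrite -[j.-1]/(val (Ordinal j1)) val_l idx /= ltnn andbF; split=> //.
by rewrite negb_and -leqNgt leq_pred orbT.
Qed.

End Sets.

Lemma Sbar_pathgf : let: u := lt mU in let: v := lt mV in let: w := lt mW in
  let: t := lt mT in
  Sbar (u + v + t) (v + t) (v + w + t) t s =
  ncsum [set n | (1 <= n)%N]%classic (fun n => pathgf (wt_last s) lt n 0 0).
Proof.
apply: eq_ncsum => n.
rewrite -(sum_prod_allowed (r := perms 0 n) (a := fun l => s ^+ rminl l)
  (al := asc_allowed)); last first.
  move=> x xn _; transitivity
    (\sum_(l <- perms 0 n | asc_compat (nth mT x) n l) s ^+ rminl l).
    rewrite big_seq_cond [RHS]big_seq_cond; apply: eq_bigl => l.
    by rewrite mem_perms; case: (boolP (perm_eq _ _)) => // /asc_allowedE ->.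
  by rewrite asc_sum_pathwt -xn mkseq_nth.
rewrite -big_perms; apply: eq_bigr => p _; rewrite rminl_plist; congr (_ *: _).
apply: eq_bigr => i _; rewrite /marks !big_cons big_nil /=.
have := Asc_short_Pasc (p := p) (i := i); have := asc_trichotomy p i.
have := mem_Pasc p i; have := mem_Asc_short p i => /= <- <- ->.
case: (i \in Pasc p); case: (i \in Asc_short p); case: (i \in Qasc p) => //=.
all: try by move=> [].
all: by rewrite ?addr0 ?addrA.
Qed.

End PermutationBracket.

(** * Silly ascents *)

Section SillyPaths.
Variables (K : comNzRingType) (s : K) (om : nat -> mark).
Hypothesis om_w : forall i, ~~ is_w (om i).
Implicit Types (l : seq nat).

Local Notation T := (is_t \o om).

(** Here the values are [1, ..., n], and the letter [om i] is about the value
    [i], or about both [i] and [i + 1], rather than about [i - 1] and [i]. *)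
Definition silly_rel (a b : nat) : bool := is_t (om b) || (a < b)%N.

(** Index 0 belongs to no [succ_set], whence the first letter [mT]; the range stops before [n]
    because the condition on [i] involves the value [i.+1]. *)
Definition silly_compat n l :=
  [&& (n == 0%N) || is_t (om 0), path silly_rel 0 l &
  all (fun i => is_u (om i) ==> (index i.+1 l < index i l)%N) (iota 1 n.-1)].

Definition silly_label n l := count T (take (index n l) l).

Definition silly_sum n (G : nat -> K) :=
  \sum_(l <- perms 1 n | silly_compat n l) s ^+ rminl l * G (silly_label n l).

Section Insertion.
Variables (n : nat) (l : seq nat).
Hypothesis lP : l \in perms 1 n.

Let lperm : perm_eq l (iota 1 n). Proof. by rewrite -mem_perms. Qed.
Let szl : size l = n. Proof. by rewrite (perm_size lperm) size_iota. Qed.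
Let meml y : (y \in l) = (0 < y <= n)%N.
Proof. by rewrite (perm_mem lperm) mem_iota add1n ltnS. Qed.
Let nl : n.+1 \notin l. Proof. by rewrite meml ltnn. Qed.

Lemma silly_compat_ins j : (j <= n)%N ->
  silly_compat n.+1 (ins n.+1 j l) = [&& is_t (om 0), silly_compat n l, gap T l j &
    (0 < n)%N && is_u (om n) ==> (j <= index n l)%N].
Proof.
move=> jn; have jl : (j <= size l)%N by rewrite szl.
rewrite /silly_compat (path_ins (T := T)); first last.
- by move=> y _ /=; rewrite /silly_rel => ->.
- by move=> y; rewrite meml /silly_rel => /andP[_ yn]; rewrite ltnNge ltnW // orbF.
have -> : silly_rel (last 0 (take j l)) n.+1.
  rewrite /silly_rel; have := mem_last 0%N (take j l).
  rewrite inE => /predU1P[->|/mem_take]; rewrite ?orbT // meml ltnS.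
  by case/andP => _ ->; rewrite orbT.
case: (is_t (om 0)); rewrite ?orbT //=.
have [n0|n_gt0] := posnP n; first by rewrite n0 /= !andbT.
have -> : iota 1 n = iota 1 n.-1 ++ [:: n].
  by rewrite -[X in iota 1 X](prednK n_gt0) -[n.-1.+1]addn1 iotaD add1n prednK.
rewrite all_cat /= andbT.
have -> : all (fun i => is_u (om i) ==>
      (index i.+1 (ins n.+1 j l) < index i (ins n.+1 j l))%N)
     (iota 1 n.-1) =
   all (fun i => is_u (om i) ==> (index i.+1 l < index i l)%N) (iota 1 n.-1).
  apply: eq_in_all => i; rewrite mem_iota /= => ii; congr (_ ==> _).
  rewrite !index_ins ?meml ?ltnn //; lia.
rewrite index_ins_new // index_ins ?meml ?n_gt0 ?ltnn ?leqnn //.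
have -> : (j < index n l + (j <= index n l))%N = (j <= index n l)%N.
  by case: (leqP j (index n l)); lia.
by case: (path _ _ l); case: (all _ _); rewrite //= ?andbF //=; case: (gap _ _ _).
Qed.

Hypothesis om0 : is_t (om 0).

Lemma silly_gap_label j : (j <= n)%N -> gap T l j ->
  ((0 < n)%N && is_u (om n) ==> (j <= index n l)%N) =
  step_ok (om n) (silly_label n l) (count T (take j l)).
Proof.
move=> jn gj; rewrite /silly_label; set i := index n l.
case E: (om n) (om_w n) => //= _; rewrite ?andbF ?andbT //=.
have n0 : (0 < n)%N by case: posnP E om0 => // -> ->.
rewrite n0 /=; have ni : (i < size l)%N by rewrite index_mem meml n0 leqnn.
apply/idP/idP => [ji|]; last by apply: contraLR; rewrite -leqNgt -ltnNge => /ltnW /count_take_mono.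
(* The letter of [n] is [mU], so the position of [n] is not a gap and [j] lies strictly before
   it. *)
apply: count_take_gap => //; last by apply: leq_ltn_trans ni.
rewrite ltn_neqAle ji andbT; apply: contraTneq gj => ->.
by rewrite /gap (drop_nth 0%N ni) nth_index ?meml ?n0 //= E.
Qed.

Lemma silly_label_ins j : (j <= n)%N ->
  silly_label n.+1 (ins n.+1 j l) = count T (take j l).
Proof.
move=> jn; rewrite /silly_label index_ins_new ?szl // /ins.
by rewrite take_size_cat // size_takel ?szl.
Qed.

Hypothesis lc : silly_compat n l.

Lemma silly_sum_ins (G : nat -> K) :
  \sum_(j < n.+1 | silly_compat n.+1 (ins n.+1 j l))
     s ^+ rminl (ins n.+1 j l) * G (silly_label n.+1 (ins n.+1 j l)) =
  s ^+ rminl l * \sum_(q < numT om n.+1 | step_ok (om n) (silly_label n l) q)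
                    wt_last s (numT om n.+1) q * G q.
Proof.
pose F q := if step_ok (om n) (silly_label n l) q then
  s ^+ (q == count T l) * G q else 0.
transitivity (s ^+ rminl l * \sum_(j < (size l).+1 | gap T l j) F (count T (take j l))).
  rewrite szl mulr_sumr [LHS]big_mkcond [RHS]big_mkcond; apply: eq_bigr => j _.
  have jn : (j <= n)%N by rewrite -ltnS.
  rewrite silly_compat_ins // lc om0 /=; case: (boolP (gap T l j)) => //= gj.
  rewrite silly_gap_label // /F; case: ifP => _; last by rewrite mulr0.
  rewrite silly_label_ins // rminl_ins ?szl //; last first.
    by apply/allP => y; rewrite meml => /andP[].
  by rewrite gap_end ?szl // exprD mulrA.
rewrite sum_gaps; congr (_ * _).
(* The virtual value 0 carries the letter [om 0], which accounts for the additional label. *)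
rewrite (_ : numT om n.+1 = (count T l).+1); last first.
  by rewrite (count_perms _ lP) /numT /= om0.
rewrite /F /wt_last [RHS]big_mkcond; apply: eq_bigr => q _.
case: ifP => // _; rewrite eqSS; congr (_ * _).
by case: eqP => _; rewrite ?expr1 ?expr0.
Qed.

End Insertion.

Lemma silly_sum0 G : silly_sum 0 G = G 0%N.
Proof. by rewrite /silly_sum big_mkcond big_seq1 /= mul1r. Qed.

Lemma silly_sumS n G : silly_sum n.+1 G = silly_sum n (fun p =>
  \sum_(q < numT om n.+1 | step_ok (om n) p q) wt_last s (numT om n.+1) q * G q).
Proof.
rewrite /silly_sum [LHS]big_mkcond big_permsS [RHS]big_mkcond /=.
rewrite [LHS]big_seq [RHS]big_seq; apply: eq_bigr => l lP.
rewrite -big_mkcond add1n; have [om0|om0] := boolP (is_t (om 0)).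
  case: ifP => lc; first exact: silly_sum_ins.
  by rewrite big1 // => j; rewrite silly_compat_ins // ?lc ?andbF // -ltnS.
(* With another first letter both sides vanish: on the right only the empty list is compatible, and
   then no label is available. *)
rewrite big1 => [|j]; last by rewrite silly_compat_ins // ?(negPf om0) // -ltnS.
case: ifP => //; rewrite /silly_compat (negPf om0) orbF => /andP[/eqP -> _].
by rewrite /numT /= (negPf om0) big_ord0 mulr0.
Qed.

Lemma silly_sum_pathwt n :
  \sum_(l <- perms 1 n | silly_compat n l) s ^+ rminl l =
  pathwt (wt_last s) (mkseq om n) 0 0.
Proof.
rewrite -(pathwt_transfer (W := silly_sum) _ silly_sum0 silly_sumS).
by apply: eq_bigr => l _; rewrite mulr1.
Qed.

End SillyPaths.

(** * The bracket of the silly ascents *)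

Section SillyBracket.
Variables (A : eqType) (K : comNzRingType) (s : K) (lt : mark -> ncps A K).
Hypothesis lt_w : lt mW = 0.

(** Values start at 1 while factors are numbered from 0; this offsets the shift made by [succ_set],
    and the factor [i] depends on the value [i]. The leftmost value is compared with the virtual
    0. *)
Definition silly_in (l : seq nat) i := (0 < i)%N && (nth 0 (0 :: l) (index i l) < i)%N.

Definition silly_allowed (l : seq nat) i c :=
  match c with
  | mT => true
  | mV => silly_in l i
  | mU => silly_in l i && (index i.+1 l < index i l)%N
  | mW => false
  end.

Lemma silly_allowedE n l x : perm_eq l (iota 1 n) -> size x = n ->
    all (fun c => ~~ is_w c) x ->
  allowed n (silly_allowed l) x = silly_compat (nth mT x) n l.
Proof.
move=> lP xn xW.
have xwi i : ~~ is_w (nth mT x i).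
  by have [ni|ni] := ltnP i (size x); [move/(all_nthP mT): xW; apply|rewrite nth_default].
rewrite /silly_compat (path_perm_iota _ _ lP).
case: n => [|n] in lP xn *; first by rewrite /allowed.
rewrite (_ : iota 1 n.+1 = iota 1 n ++ [:: n.+1]); last first.
  by rewrite -[X in iota _ X = _]addn1 iotaD.
rewrite /allowed all_cat /= /silly_rel.
(* The letter of the greatest value lies beyond the end of the word; its default [mT] imposes
   nothing. *)
rewrite [nth mT x n.+1]nth_default ?xn //= andbT -all_predI.
have -> : silly_allowed l 0 (nth mT x 0%N) = is_t (nth mT x 0%N).
  by case: (nth mT x 0%N) (xwi 0%N) => //=; rewrite /silly_in.
congr (_ && _); apply: eq_in_all => i; rewrite mem_iota /= => ilt.
have i0 : (0 < i)%N by lia.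
by case: (nth mT x i) (xwi i) => //=; rewrite /silly_in i0 ?andbT.
Qed.

Section Sets.
Variables (n : nat) (p : 'S_n).
Local Notation l := (plist 1 p).

Let idx (j : 'I_n) : index (p j).+1 l = j. Proof. exact: (index_plist 1). Qed.
Let val_l (j : 'I_n) : nth 0%N l j = (p j).+1. Proof. exact: (nth_plist 1). Qed.

Let silly_inP (j : 'I_n) : ((p j).+1 < n)%N ->
  silly_ascent_at p j = silly_in l (p j).+1.
Proof.
move=> pjn; rewrite /silly_in idx /silly_ascent_at pjn /=.
case jE : (j : nat) => [|j'] //=; apply/existsP/idP => [[i0 /andP[/eqP ji pij]]|].
  by rewrite (_ : j' = i0) ?val_l //; lia.
have j1 : (j' < n)%N by have := ltn_ord j; lia.
rewrite -[j']/(val (Ordinal j1)) val_l => lt_p; exists (Ordinal j1).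
by rewrite /ascent_at jE eqxx.
Qed.

Let preP (i : 'I_n) : (0 < i)%N -> exists j k : 'I_n,
  [/\ i = (p j).+1 :> nat, i = p k & index (i : nat) l = j /\ index i.+1 l = k].
Proof.
move=> i0; have i1 : (i.-1 < n)%N by have := ltn_ord i; lia.
exists ((p^-1)%g (Ordinal i1)), ((p^-1)%g i).
have E : i = (p ((p^-1)%g (Ordinal i1))).+1 :> nat by rewrite permKV /= prednK.
have F : i = p ((p^-1)%g i) by rewrite permKV.
by split=> //; split; rewrite -[RHS]idx -?E -?F.
Qed.

Lemma mem_succ_Psilly (i : 'I_n) :
  (i \in succ_set (Psilly p)) = silly_allowed l i mU.
Proof.
rewrite inE /=; apply/idP/idP.
  case/existsP=> i' /andP[]; rewrite inE => /existsP[j /existsP[k]].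
  case/and4P => asc /eqP -> /eqP pk kj /eqP ip.
  have pjn : ((p j).+1 < n)%N by rewrite -ip.
  by rewrite ip -silly_inP // asc -[X in (index X.+1 l < _)%N]pk !idx.
case/andP => /andP[i0 asc]; have [j [k [ij ik [jE kE]]]] := preP i0.
rewrite jE kE => kj; apply/existsP; exists (p j); rewrite ij eqxx andbT inE.
apply/existsP; exists j; apply/existsP; exists k; rewrite silly_inP -ij //.
by rewrite /silly_in i0 asc eqxx -ik eqxx.
Qed.

Lemma mem_succ_Qsilly (i : 'I_n) :
  (i \in succ_set (Qsilly p)) = silly_in l i && (index (i : nat) l < index i.+1 l)%N.
Proof.
rewrite inE /=; apply/idP/idP.
  case/existsP=> i' /andP[]; rewrite inE => /existsP[j /existsP[k]].
  case/and4P => asc /eqP -> /eqP pk kj /eqP ip.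
  have pjn : ((p j).+1 < n)%N by rewrite -ip.
  by rewrite ip -silly_inP // asc -[X in (_ < index X.+1 l)%N]pk !idx.
case/andP => /andP[i0 asc]; have [j [k [ij ik [jE kE]]]] := preP i0.
rewrite jE kE => kj; apply/existsP; exists (p j); rewrite ij eqxx andbT inE.
apply/existsP; exists j; apply/existsP; exists k; rewrite silly_inP -ij //.
by rewrite /silly_in i0 asc eqxx -ik eqxx.
Qed.

Lemma silly_inE (i : 'I_n) : silly_in l i =
  (i \in succ_set (Psilly p)) || (i \in succ_set (Qsilly p)).
Proof.
rewrite mem_succ_Psilly mem_succ_Qsilly /= -andb_orr.
case: (boolP (silly_in l i)) => // /andP[i0 _].
have [j [k [ij ik [-> ->]]]] := preP i0; rewrite -neq_ltn.
apply/esym/eqP => /val_inj kj; move: ij; rewrite ik kj; lia.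
Qed.

End Sets.

Lemma Sbar_silly_pathgf : let: u := lt mU in let: v := lt mV in
  let: t := lt mT in
  Sbar_silly (u + v + t) (v + t) t s =
  ncsum [set n | (1 <= n)%N]%classic (fun n => pathgf (wt_last s) lt n 0 0).
Proof.
apply: eq_ncsum => n.
rewrite -(sum_prod_allowed (r := perms 1 n) (a := fun l => s ^+ rminl l)
  (al := silly_allowed)); last first.
  move=> x xn; rewrite lt_w eqxx orbF => xW; transitivity
    (\sum_(l <- perms 1 n | silly_compat (nth mT x) n l) s ^+ rminl l).
    rewrite big_seq_cond [RHS]big_seq_cond; apply: eq_bigl => l.
    rewrite mem_perms; case: (boolP (perm_eq _ _)) => // lP.
    by rewrite silly_allowedE.
  rewrite silly_sum_pathwt -?xn ?mkseq_nth // => i.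
  by have [ni|ni] := ltnP i (size x); [move/(all_nthP mT): xW; apply|rewrite nth_default].
rewrite -big_perms; apply: eq_bigr => p _; rewrite rminl_plist; congr (_ *: _).
apply: eq_bigr => i _; rewrite /marks !big_cons big_nil /=.
have := silly_inE p i; have := mem_succ_Psilly p i => /= <- ->.
case: (i \in succ_set (Psilly p)); case: (i \in succ_set (Qsilly p)) => //=.
all: by rewrite ?addr0 ?addrA.
Qed.

End SillyBracket.

(** * Matchings without left nestings *)

Lemma iota_rcons a n : iota a n.+1 = rcons (iota a n) (a + n)%N.
Proof. by rewrite -[X in iota _ X = _]addn1 iotaD cats1. Qed.

(** * Codes bounded by the index, and their labelled words *)

Fixpoint codes n : seq (seq nat) :=
  if n is n'.+1 then [seq rcons d x | d <- codes n', x <- iota 0 n'.+1]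
  else [:: [::]].

Lemma mem_codes n d :
  (d \in codes n) = (size d == n) && all (fun i => (nth 0 d i <= i)%N) (iota 0 n).
Proof.
elim: n d => [|n IH] d; first by rewrite inE andbT; case: d.
apply/allpairsPdep/andP => [[d' [x [d'P xn ->]]]|[/eqP dn]].
  move: d'P xn; rewrite IH mem_iota leq0n add0n andTb ltnS => /andP[/eqP sd d'P] xn.
  rewrite size_rcons sd iota_rcons all_rcons add0n nth_rcons sd ltnn !eqxx xn.
  split=> //; apply/allP => i.
  rewrite mem_iota /= => ilt; rewrite nth_rcons sd ilt.
  by apply: (allP d'P); rewrite mem_iota.
case/lastP: d dn => [//|d x]; rewrite size_rcons => -[dn].
rewrite iota_rcons all_rcons add0n nth_rcons dn ltnn eqxx => /andP[xn dP].
have xi : x \in rcons (iota 0 n) n by rewrite -(iota_rcons 0) mem_iota.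
have dc : d \in codes n.
  rewrite IH dn eqxx; apply/allP => i iP; have := allP dP i iP.
  by move: iP; rewrite mem_iota nth_rcons dn /= => ->.
by exists d, x; split.
Qed.

Lemma codes_uniq n : uniq (codes n).
Proof.
elim: n => [//|n IH]; apply: allpairs_uniq_dep => //.
  by move=> d _; apply: iota_uniq.
move=> [d x] [d' x'] _ _ /= /rcons_inj[-> ->] //.
Qed.

Lemma big_codesS (V : zmodType) n (F : seq nat -> V) :
  \sum_(d <- codes n.+1) F d =
  \sum_(d <- codes n) \sum_(x < n.+1) F (rcons d x).
Proof.
rewrite -[codes n.+1]/[seq rcons d x | d <- codes n, x <- iota 0 n.+1].
rewrite big_allpairs_dep; apply: eq_bigr => d _.
by rewrite -[iota 0 n.+1]/(index_iota 0 n.+1) big_mkord.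
Qed.

Section CodePaths.
Variables (K : comNzRingType) (s : K) (om : nat -> mark).
Implicit Types (d : seq nat).

Local Notation T := (is_t \o om).

(** For [i = 0] the index [i.-1] is [i], and [step_ok] alone would accept [mW]; in a nonempty code
    the first entry is 0, so [all T d] forces [mT] there. *)
Definition code_compat n d := all T d &&
  all (fun i => step_ok (om i) (nth 0%N d i.-1) (nth 0%N d i)) (iota 0 n).

Definition code_label d := numT om (last 0%N d).

Definition code_sum n (G : nat -> K) :=
  \sum_(d <- codes n | code_compat n d) s ^+ count_mem 0%N d * G (code_label d).

Lemma numT_mono i j : (i <= j)%N -> (numT om i <= numT om j)%N.
Proof. by move=> ij; rewrite -(subnKC ij) /numT iotaD count_cat leq_addr. Qed.

Lemma numT_lt i j : T i -> (numT om i < numT om j)%N = (i < j)%N.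
Proof.
move=> Ti; apply/idP/idP => [|ij].
  by apply: contraLR; rewrite -!leqNgt; apply: numT_mono.
by apply: leq_trans (numT_mono ij); rewrite numTS (Ti : is_t (om i)) addn1.
Qed.

Lemma sum_numT n (F : nat -> K) :
  \sum_(x < n | T x) F (numT om x) = \sum_(q < numT om n) F q.
Proof.
elim: n => [|n IH]; first by rewrite !big_ord0.
rewrite big_mkcond big_ord_recr -big_mkcond IH numTS /=.
by case: (is_t (om n)); rewrite ?addn1 ?addn0 ?addr0 ?big_ord_recr.
Qed.

Section Insertion.
Variables (n : nat) (d : seq nat).
Hypothesis dP : d \in codes n.

Let szd : size d = n. Proof. by move: dP; rewrite mem_codes => /andP[/eqP]. Qed.

Lemma code_compat_rcons x : (x <= n)%N ->
  code_compat n.+1 (rcons d x) =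
  [&& code_compat n d, T x & step_ok (om n) (last 0%N d) x].
Proof.
move=> xn; rewrite /code_compat all_rcons iota_rcons all_rcons add0n.
have -> : all (fun i => step_ok (om i)
      (nth 0%N (rcons d x) i.-1) (nth 0%N (rcons d x) i)) (iota 0 n) =
    all (fun i => step_ok (om i) (nth 0%N d i.-1) (nth 0%N d i)) (iota 0 n).
  apply: eq_in_all => i; rewrite mem_iota /= => ilt.
  by rewrite !nth_rcons szd ilt (_ : (i.-1 < n)%N = true) //; lia.
have -> : nth 0%N (rcons d x) n = x by rewrite nth_rcons szd ltnn eqxx.
have -> : nth 0%N (rcons d x) n.-1 = last 0%N d.
  rewrite -[RHS](nth_last 0%N) nth_rcons szd; case: ltnP => // nn.
  have n0 : n = 0%N by lia.
  by rewrite [RHS]nth_default ?szd ?n0 //; move: xn; rewrite n0 leqn0 => /eqP ->.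
rewrite /=; case: (is_t (om x)); case: (all _ d); rewrite //= ?andbF //.
by rewrite andbC.
Qed.

Hypothesis dc : code_compat n d.

Let om0 : (0 < n)%N -> T 0%N.
Proof.
move=> n0; case/andP: dc => /allP dT _.
have d0 : nth 0%N d 0 = 0%N.
  move: dP; rewrite mem_codes => /andP[_ /allP/(_ 0%N)].
  by rewrite mem_iota /= n0 leqn0 => /(_ isT)/eqP.
by rewrite -d0; have /dT // : nth 0%N d 0 \in d by rewrite mem_nth ?szd.
Qed.

Let last_t : (0 < n)%N -> T (last 0%N d).
Proof.
case/andP: dc => /allP dT _ n0; have /dT // : last 0%N d \in d.
by case: (d) szd n0 => [<-|y d' _ _] //=; rewrite mem_last.
Qed.

(** [numT] is strictly increasing on the positions of the letters [mT], so these positions and their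
    ranks are ordered alike. *)
Lemma code_step_label x : (x <= n)%N -> T x ->
  step_ok (om n) (last 0%N d) x = step_ok (om n) (code_label d) (numT om x).
Proof.
move=> xn Tx; rewrite /code_label; case: (om n) => //=; first by rewrite numT_lt.
have [n0|/last_t Tl] := posnP n.
  have /size0nil -> : size d = 0%N by rewrite szd.
  by rewrite /= (_ : x = 0%N) //; lia.
by rewrite !eqn_leq; congr (_ && _); rewrite [LHS]leqNgt [RHS]leqNgt numT_lt.
Qed.

Lemma numT_eq0 x : (x <= n)%N -> (numT om x == 0%N) = (x == 0%N).
Proof.
move=> xn; have [n0|/om0 T0] := posnP n; first by have -> : x = 0%N by lia.
by apply: negb_inj; rewrite -!lt0n -[RHS](numT_lt x T0).
Qed.

Lemma code_sum_rcons (G : nat -> K) :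
  \sum_(x < n.+1 | code_compat n.+1 (rcons d x))
     s ^+ count_mem 0%N (rcons d x) * G (code_label (rcons d x)) =
  s ^+ count_mem 0%N d * \sum_(q < numT om n.+1 | step_ok (om n) (code_label d) q)
                    wt_first s (numT om n.+1) q * G q.
Proof.
pose F q := if step_ok (om n) (code_label d) q then s ^+ (q == 0%N) * G q else 0.
transitivity (s ^+ count_mem 0%N d * \sum_(x < n.+1 | T x) F (numT om x)).
  rewrite mulr_sumr [LHS]big_mkcond [RHS]big_mkcond; apply: eq_bigr => x _.
  have xn : (x <= n)%N by rewrite -ltnS.
  rewrite code_compat_rcons // dc andTb; case: (boolP (T x)) => //= Tx.
  rewrite code_step_label // /F; case: ifP => _; last by rewrite mulr0.
  rewrite /code_label last_rcons -cats1 count_cat /= addn0 numT_eq0 //.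
  by rewrite exprD mulrA.
rewrite sum_numT; congr (_ * _); rewrite [RHS]big_mkcond; apply: eq_bigr => q _.
rewrite /F /wt_first; case: ifP => // _; congr (_ * _).
by case: eqP => _; rewrite ?expr1 ?expr0.
Qed.

End Insertion.

Lemma code_sum0 G : code_sum 0 G = G 0%N.
Proof. by rewrite /code_sum big_mkcond big_seq1 /= mul1r. Qed.

Lemma code_sumS n G : code_sum n.+1 G = code_sum n (fun p =>
  \sum_(q < numT om n.+1 | step_ok (om n) p q) wt_first s (numT om n.+1) q * G q).
Proof.
rewrite /code_sum [LHS]big_mkcond big_codesS [RHS]big_mkcond /=.
rewrite [LHS]big_seq [RHS]big_seq; apply: eq_bigr => d dP.
rewrite -big_mkcond; case: ifP => dc; first exact: code_sum_rcons.
by rewrite big1 // => x; rewrite code_compat_rcons // ?dc // -ltnS.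
Qed.

Lemma code_sum_pathwt n :
  \sum_(d <- codes n | code_compat n d) s ^+ count_mem 0%N d =
  pathwt (wt_first s) (mkseq om n) 0 0.
Proof.
rewrite -(pathwt_transfer (W := code_sum) _ code_sum0 code_sumS).
by apply: eq_bigr => d _; rewrite mulr1.
Qed.

End CodePaths.

(** [i \notin d] says that the closers [i.-1] and [i] are adjacent; a descent, an equality or a rise
    of the code at [i] then gives [Rne], [LRcr] or [Rcr0]. *)
Definition code_allowed (d : seq nat) i c :=
  match c with
  | mT => true
  | _ => (i \notin d) && step_ok c (nth 0%N d i.-1) (nth 0%N d i)
  end.

Lemma code_allowedE n d x : d \in codes n ->
  allowed n (code_allowed d) x = code_compat (nth mT x) n d.
Proof.
rewrite mem_codes => /andP[/eqP dn /allP dP].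
have dlt y : y \in d -> (y < n)%N.
  case/(nthP 0%N) => i; rewrite dn => ilt <-; apply: leq_ltn_trans (ilt).
  by apply: dP; rewrite mem_iota.
have -> : code_compat (nth mT x) n d =
  all (fun i => (i \in d) ==> is_t (nth mT x i)) (iota 0 n) &&
  all (fun i => step_ok (nth mT x i) (nth 0%N d i.-1) (nth 0%N d i)) (iota 0 n).
  congr (_ && _); apply/allP/allP => H i id /=.
    by apply/implyP => /H.
  have ii : i \in iota 0 n by rewrite mem_iota dlt.
  by have /implyP := H i ii; apply.
rewrite -all_predI; apply: eq_all => i /=.
by case: (nth mT x i); rewrite //= ?implybT ?implybF ?andbT.
Qed.

(** * Openers and closers as sequences of numbers *)

Lemma count_initial (P : pred nat) n j :
    (forall i k, (i < k)%N -> (k < n)%N -> P k -> P i) -> (j < n)%N ->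
  P j = (j < count P (iota 0 n))%N.
Proof.
elim: n => [//|n IH] Pdown; rewrite ltnS => jn.
have Pd i k : (i < k)%N -> (k < n)%N -> P k -> P i.
  by move=> ik kn; apply: Pdown; rewrite // ltnW.
rewrite iota_rcons -cats1 count_cat /= add0n addn0; have [Pn|Pn] := boolP (P n).
  have Pall : all P (iota 0 n).
    by apply/allP => i; rewrite mem_iota /= => ilt; apply: Pdown Pn.
  move: Pall; rewrite all_count size_iota => /eqP ->.
  rewrite addn1 ltnS jn; move: jn; rewrite leq_eqVlt => /predU1P[->//|jn].
  exact: Pdown Pn.
rewrite addn0; move: jn; rewrite leq_eqVlt => /predU1P[->|]; last exact: IH.
by rewrite (negPf Pn) ltnNge -{2}(size_iota 0 n) count_size.
Qed.

Lemma count_ltn n i : (i <= n)%N -> count (fun j => j < i)%N (iota 0 n) = i.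
Proof.
move=> ilt; rewrite -(subnKC ilt) iotaD count_cat add0n -[RHS]addn0; congr addn.
  rewrite -[RHS](size_iota 0); apply/eqP; rewrite -all_count.
  by apply/allP => j; rewrite mem_iota.
rewrite (eq_in_count (a2 := pred0)) ?count_pred0 // => j.
by rewrite mem_iota; case/andP; rewrite leqNgt => /negPf.
Qed.

(** [o i] and [c i] are the opener and the closer of the arc [i], the arcs being
    numbered by increasing closer. *)
Definition arc_data n (o c : nat -> nat) :=
  [/\ perm_eq (mkseq o n ++ mkseq c n) (iota 0 n.*2),
      forall i, (i < n)%N -> (o i < c i)%N &
      forall i j, (i < j)%N -> (j < n)%N -> (c i < c j)%N].

Definition no_left_nesting n (o c : nat -> nat) :=
  forall i j, (i < n)%N -> (j < n)%N -> o i = (o j).+1 -> ~~ (c i < c j)%N.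

Definition arc_code n (o c : nat -> nat) i := count (fun j => c j < o i)%N (iota 0 n).

Definition lex_lt (d : nat -> nat) j i :=
  ((d j < d i) || (d j == d i) && (j < i))%N.

(** The number of points before the closer [i]: there are [i] closers, and the openers of the arcs
    [j] with [d j <= i]. *)
Definition code_closer n (d : nat -> nat) i :=
  (i + count (fun j => d j <= i) (iota 0 n))%N.

(** Likewise, [d i] closers precede the opener [i], and without left nesting the openers come in the
    lexicographic order of the pairs [(d j, j)]. *)
Definition code_opener n (d : nat -> nat) i :=
  (d i + count (fun j => lex_lt d j i) (iota 0 n))%N.

Section ArcData.
Variables (n : nat) (o c : nat -> nat).
Hypothesis D : arc_data n o c.

Local Notation d := (arc_code n o c).

Let oc_perm : perm_eq (mkseq o n ++ mkseq c n) (iota 0 n.*2). Proof. by case: D. Qed.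
Let o_lt_c i : (i < n)%N -> (o i < c i)%N. Proof. by case: D => _ + _; apply. Qed.

Lemma arc_closer_lt i j : (i < n)%N -> (j < n)%N -> (c i < c j)%N = (i < j)%N.
Proof.
case: D => _ _ c_mono ilt jn; case: (ltngtP i j) => [ij|ji|->]; last by rewrite ltnn.
  exact: c_mono.
by rewrite ltnNge ltnW // c_mono.
Qed.

Let oc_uniq : uniq (mkseq o n ++ mkseq c n).
Proof. by rewrite (perm_uniq oc_perm) iota_uniq. Qed.

Lemma arc_opener_inj i j : (i < n)%N -> (j < n)%N -> o i = o j -> i = j.
Proof.
move=> ilt jn; move: oc_uniq; rewrite cat_uniq => /andP[/mkseq_uniqP oinj _].
exact: oinj.
Qed.

Lemma arc_opener_closer i j : (i < n)%N -> (j < n)%N -> o i <> c j.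
Proof.
move=> ilt jn E; move: oc_uniq; rewrite cat_uniq => /and3P[_ /hasPn oc _].
have /oc/negP : c j \in mkseq c n by apply: map_f; rewrite mem_iota.
by apply; rewrite -E; apply: map_f; rewrite mem_iota.
Qed.

Lemma arc_cover x : (x < n.*2)%N -> exists2 i, (i < n)%N & x = o i \/ x = c i.
Proof.
move=> xn; have : x \in mkseq o n ++ mkseq c n by rewrite (perm_mem oc_perm) mem_iota.
rewrite mem_cat; case/orP; case/mapP => i; rewrite mem_iota => ilt ->; exists i => //.
  by left.
by right.
Qed.

Lemma arc_lt i : (i < n)%N -> (o i < n.*2)%N /\ (c i < n.*2)%N.
Proof.
move=> ilt.
have H x : x \in mkseq o n ++ mkseq c n -> (x < n.*2)%N.
  by rewrite (perm_mem oc_perm) mem_iota.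
by split; apply: H; rewrite mem_cat !map_f ?orbT // mem_iota.
Qed.

Lemma arc_count x : (x <= n.*2)%N ->
  (count (fun j => o j < x) (iota 0 n) + count (fun j => c j < x) (iota 0 n))%N = x.
Proof.
move=> xn; have /seq.permP/(_ (fun y => y < x)%N) := oc_perm.
by rewrite count_ltn // count_cat !count_map.
Qed.

Lemma closer_lt_opener i j : (i < n)%N -> (j < n)%N ->
  (c j < o i)%N = (j < d i)%N.
Proof.
move=> ilt jn; apply: (@count_initial (fun k => c k < o i)%N) => // k m km mn.
by apply: leq_ltn_trans; rewrite ltnW // arc_closer_lt // (ltn_trans km).
Qed.

Lemma arc_code_le i : (i < n)%N -> (d i <= i)%N.
Proof.
by move=> ilt; rewrite leqNgt -closer_lt_opener // -leqNgt ltnW // o_lt_c.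
Qed.

Lemma opener_lt_closer i j : (i < n)%N -> (j < n)%N ->
  (o j < c i)%N = (d j <= i)%N.
Proof.
move=> ilt jn; rewrite [RHS]leqNgt -closer_lt_opener // -leqNgt [RHS]leq_eqVlt.
by case: eqP => // /arc_opener_closer -[].
Qed.

Lemma arc_closerE i : (i < n)%N -> c i = code_closer n d i.
Proof.
move=> ilt; have [_ cn] := arc_lt ilt; rewrite -[LHS](arc_count (ltnW cn)) addnC.
congr addn; last first.
  by apply: eq_in_count => j; rewrite mem_iota => jn; rewrite opener_lt_closer.
rewrite -[RHS](count_ltn (ltnW ilt)).
by apply: eq_in_count => j; rewrite mem_iota => jn; rewrite arc_closer_lt.
Qed.

Hypothesis NL : no_left_nesting n o c.

Let d_mono i j : (o i <= o j)%N -> (d i <= d j)%N.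
Proof. by move=> ij; apply: sub_count => k /= /leq_trans; apply. Qed.

(** As the codes agree, no closer separates the two openers, so the point after [o i] is some [o k].
    The absence of left nesting gives [i <= k], and the distance from [o k] to [o j] is smaller. *)
Let same_run m i j : (i < n)%N -> (j < n)%N -> o j = (o i + m)%N -> d i = d j ->
  (i <= j)%N.
Proof.
elim: m i => [|m IH] i ilt jn oij dij.
  by rewrite (arc_opener_inj ilt jn) // oij addn0.
have [on _] := arc_lt jn.
have [|k kn [ok|ck]] := @arc_cover (o i).+1; first by lia.
  have kj : (k <= j)%N.
    apply: IH => //; first by rewrite -ok; lia.
    by apply/eqP; rewrite eqn_leq -{2}dij !d_mono // -ok; lia.
  apply: leq_trans kj; rewrite leqNgt -arc_closer_lt //.
  exact: NL.
have : (o i < c k)%N by lia.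
have : (c k <= o j)%N by lia.
rewrite opener_lt_closer // leq_eqVlt => /predU1P[/esym/arc_opener_closer -[]//|].
by rewrite closer_lt_opener // dij; lia.
Qed.

Lemma opener_lt i j : (i < n)%N -> (j < n)%N -> (o j < o i)%N = lex_lt d j i.
Proof.
have H k m : (k < n)%N -> (m < n)%N -> lex_lt d k m -> (o k < o m)%N.
  move=> kn mn /orP[dkm|/andP[/eqP dkm km]].
    (* The closer numbered [d k] separates the two openers. *)
    have dkn : (d k < n)%N by apply: leq_ltn_trans (kn); apply: arc_code_le.
    apply: (@ltn_trans (c (d k))); first by rewrite opener_lt_closer.
    by rewrite closer_lt_opener.
  rewrite ltnNge; apply/negP => omk.
  have := @same_run (o k - o m)%N m k mn kn; rewrite subnKC // => /(_ erefl (esym dkm)).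
  by rewrite leqNgt km.
move=> ilt jn; apply/idP/idP => [oji|]; last exact: H.
apply: contraLR oji; rewrite -leqNgt => nlex.
have [->|ij] := eqVneq i j; first by [].
by apply/ltnW/H => //; move: nlex ij; rewrite /lex_lt; lia.
Qed.

Lemma arc_openerE i : (i < n)%N -> o i = code_opener n d i.
Proof.
move=> ilt; have [on _] := arc_lt ilt; rewrite -[LHS](arc_count (ltnW on)) addnC.
congr addn.
by apply: eq_in_count => j; rewrite mem_iota => jn; rewrite opener_lt.
Qed.

(** The openers between the closers [i.-1] and [i] are those of the arcs with code [i]. *)
Lemma closer_succ i : (0 < i)%N -> (i < n)%N ->
  (c i == (c i.-1).+1) = (i \notin mkseq d n).
Proof.
case: i => //= i _ ilt; rewrite !arc_closerE // 1?ltnW // /code_closer.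
have -> : count (fun j => d j <= i.+1)%N (iota 0 n) =
  (count (fun j => d j <= i)%N (iota 0 n) + count_mem i.+1 (mkseq d n))%N.
  rewrite count_map -count_predUI [X in (_ + X)%N](eq_count (a2 := pred0)).
    by rewrite count_pred0 addn0; apply: eq_count => j /=; lia.
  by move=> j /=; lia.
have -> : (i.+1 \notin mkseq d n) = (count_mem i.+1 (mkseq d n) == 0%N).
  by apply/count_memPn/eqP.
lia.
Qed.

(** If the code increases, the closer numbered by its former value lies between the two openers; if
    it is constant, [i.-1] is the only arc that precedes [i] without preceding [i.-1] in
    [lex_lt]. *)
Lemma opener_succ i : (0 < i)%N -> (i < n)%N ->
  (o i == (o i.-1).+1) = (d i == d i.-1).
Proof.
case: i => //= i _ ilt; have i'lt := ltnW ilt; apply/eqP/eqP => [oi|dE].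
  have : (o i < o i.+1)%N by lia.
  rewrite opener_lt // => /orP[di|/andP[/eqP -> //]].
  have dn : (d i < n)%N by apply: leq_ltn_trans (i'lt); apply: arc_code_le.
  have : (o i < c (d i))%N by rewrite opener_lt_closer.
  have : (c (d i) < o i.+1)%N by rewrite closer_lt_opener.
  lia.
rewrite !arc_openerE // /code_opener dE -addnS; congr addn.
transitivity (count (fun j => lex_lt d j i) (iota 0 n) + count_mem i (iota 0 n))%N.
  rewrite -count_predUI [X in (_ + X)%N](eq_count (a2 := pred0)).
    rewrite count_pred0 addn0; apply: eq_count => j /=; rewrite /lex_lt dE.
    by have [->|ji] := eqVneq j i; lia.
  by move=> j /=; rewrite /lex_lt; have [->|ji] := eqVneq j i; lia.
by rewrite count_uniq_mem ?iota_uniq // mem_iota /= i'lt addn1.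
Qed.

End ArcData.

Lemma count_lt (P Q : pred nat) (r : seq nat) j : subpred P Q -> j \in r ->
  ~~ P j -> Q j -> (count P r < count Q r)%N.
Proof.
move=> PQ + Pj Qj; elim: r => [//|x r IH]; rewrite inE /=.
case/predU1P => [<-|/IH lt_r]; last first.
  by rewrite -addnS leq_add //; case: (boolP (P x)) => // /PQ ->.
by rewrite (negPf Pj) Qj add0n add1n ltnS; apply: sub_count.
Qed.

(** * Arcs reconstructed from a code *)

Section CodeData.
Variables (n : nat) (d : nat -> nat).
Hypothesis d_le : forall i, (i < n)%N -> (d i <= i)%N.

Local Notation o := (code_opener n d).
Local Notation c := (code_closer n d).

Lemma code_closer_mono i j : (i < j)%N -> (c i < c j)%N.
Proof.
move=> ij; rewrite /code_closer -addSn leq_add //; apply: sub_count => k /= dk.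
by apply: leq_trans dk _; apply: ltnW.
Qed.

Lemma code_opener_mono i j : (j < n)%N -> lex_lt d j i -> (o j < o i)%N.
Proof.
move=> jn ji; rewrite /code_opener -addnS leq_add //.
  by move: ji; rewrite /lex_lt; lia.
apply: (@count_lt _ _ _ j); rewrite ?mem_iota //; last by rewrite /lex_lt; lia.
by move=> k; move: ji; rewrite /lex_lt; lia.
Qed.

Lemma code_opener_lt_closer i j : (i < n)%N -> (d i <= j)%N -> (o i < c j)%N.
Proof.
move=> ilt dij; rewrite /code_opener /code_closer -addnS leq_add //.
apply: (@count_lt _ _ _ i); rewrite ?mem_iota //; last by rewrite /lex_lt; lia.
by move=> k; rewrite /lex_lt; lia.
Qed.

Lemma code_closer_lt_opener i j : (j < d i)%N -> (c j < o i)%N.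
Proof.
move=> dij; rewrite /code_opener /code_closer -addSn leq_add //.
by apply: sub_count => k /=; rewrite /lex_lt; lia.
Qed.

(** The openers and closers are [n.*2] distinct numbers below [n.*2], so they exhaust the points. *)
Lemma code_arc_data : arc_data n o c.
Proof.
have oc i : (i < n)%N -> (o i < c i)%N.
  by move=> ilt; apply: code_opener_lt_closer => //; apply: d_le.
have c_lt i : (i < n)%N -> (c i < n.*2)%N.
  move=> ilt; rewrite /code_closer -addnn -addSn leq_add //.
  by rewrite -[X in (_ <= X)%N](size_iota 0 n) count_size.
have s_uniq : uniq (mkseq o n ++ mkseq c n).
  rewrite cat_uniq; apply/and3P; split.
  - apply/mkseq_uniqP => i j; rewrite !inE => ilt jn oij.
    have [//|ij] := eqVneq i j.
    have /orP[/(code_opener_mono ilt)|/(code_opener_mono jn)] : lex_lt d i j || lex_lt d j i.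
    + by rewrite /lex_lt; lia.
    + by rewrite oij ltnn.
    + by rewrite oij ltnn.
  - apply/hasPn => x /mapP[j]; rewrite mem_iota => jn ->.
    apply/negP; case/mapP => i; rewrite mem_iota => ilt ji.
    have [dij|jd] := leqP (d i) j.
      by have := code_opener_lt_closer ilt dij; rewrite ji ltnn.
    by have := code_closer_lt_opener jd; rewrite ji ltnn.
  - apply/mkseq_uniqP => i j; rewrite !inE => ilt jn cij.
    case: (ltngtP i j) => // /code_closer_mono; by rewrite cij ltnn.
have s_sub : {subset mkseq o n ++ mkseq c n <= iota 0 n.*2}.
  move=> x; rewrite mem_cat !mem_iota; case/orP; case/mapP => i; rewrite mem_iota => ilt ->.
    by apply: ltn_trans (oc i ilt) (c_lt i ilt).
  exact: c_lt.
split=> //; last by move=> i j ij _; apply: code_closer_mono.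
have [|_ s_mem] := uniq_min_size s_uniq s_sub.
  by rewrite size_cat !size_mkseq size_iota addnn.
by apply: uniq_perm => //; apply: iota_uniq.
Qed.

(** In a left nesting the inner arc would have the larger code, and the closer numbered [d j] would
    lie strictly between two adjacent openers. *)
Lemma code_no_left_nesting : no_left_nesting n o c.
Proof.
move=> i j ilt jn oij; apply/negP => cij.
have ij : (i < j)%N.
  by case: (ltngtP i j) cij => // [/code_closer_mono|->]; lia.
have dji : (d j < d i)%N.
  rewrite ltnNge; apply/negP => dij.
  have /(code_opener_mono ilt) : lex_lt d i j by rewrite /lex_lt; lia.
  by rewrite oij; lia.
have := code_closer_lt_opener dji; have := code_opener_lt_closer jn (leqnn (d j)).
by rewrite oij; lia.
Qed.

Lemma code_arc_code i : (i < n)%N -> arc_code n o c i = d i.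
Proof.
move=> ilt; rewrite /arc_code -[RHS](@count_ltn n); last first.
  by apply: leq_trans (d_le ilt) (ltnW ilt).
apply: eq_count => j /=; case: (leqP (d i) j) => [dij|]; last exact: code_closer_lt_opener.
by apply/negbTE; rewrite -leqNgt ltnW // code_opener_lt_closer.
Qed.

End CodeData.

(** * Matchings as sets of arcs *)

Lemma bigminn_le (I : eqType) (r : seq I) (P : pred I) (F : I -> nat) m i :
  i \in r -> P i -> (\big[minn/m]_(k <- r | P k) F k <= F i)%N.
Proof.
elim: r => [//|k r IH]; rewrite inE big_cons => /predU1P[<-|ir] Pi.
  by rewrite Pi geq_minl.
by case: ifP => _; rewrite ?geq_min IH ?orbT.
Qed.

Definition arcset n (a b : nat) : {set 'I_n.*2} :=
  [set x : 'I_n.*2 | (x == a :> nat) || (x == b :> nat)].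

Section Arcset.
Variables (n a b : nat).
Hypotheses (ab : (a < b)%N) (bn : (b < n.*2)%N).

Let an : (a < n.*2)%N. Proof. exact: ltn_trans bn. Qed.

Lemma arcsetE : arcset n a b = [set Ordinal an; Ordinal bn].
Proof. by apply/setP => x; rewrite !inE -!val_eqE. Qed.

Lemma card_arcset : #|arcset n a b| = 2.
Proof. by rewrite arcsetE cards2 -val_eqE /= ltn_eqF. Qed.

Lemma opener_arcset : opener (arcset n a b) = a.
Proof.
apply/eqP; rewrite eqn_leq; apply/andP; split.
  have -> : a = Ordinal an by [].
  by apply: bigminn_le; rewrite ?mem_index_enum // inE eqxx.
apply: (big_ind (leq a)); first exact: ltnW.
  by move=> x y ax ay; rewrite leq_min ax.
by move=> x; rewrite inE => /orP[] /eqP -> //; apply: ltnW.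
Qed.

Lemma closer_arcset : closer (arcset n a b) = b.
Proof.
apply/eqP; rewrite eqn_leq; apply/andP; split.
  by apply/bigmax_leqP => x; rewrite inE => /orP[] /eqP -> //; apply: ltnW.
have {1}-> : b = Ordinal bn by [].
by apply: (@leq_bigmax_cond _ _ (fun x => nat_of_ord x)); rewrite inE eqxx orbT.
Qed.

End Arcset.

Lemma card2_arcset n (B : {set 'I_n.*2}) : #|B| = 2 ->
  B = arcset n (opener B) (closer B) /\ (opener B < closer B < n.*2)%N.
Proof.
move=> /eqP/cards2P[x [y [xy ->]]].
have H (a b : 'I_n.*2) : (a < b)%N -> [set a; b] = arcset n a b.
  by move=> ab; apply/setP => z; rewrite !inE -!val_eqE.
have K (a b : 'I_n.*2) : (a < b)%N ->
  [set a; b] = arcset n (opener [set a; b]) (closer [set a; b]) /\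
  (opener [set a; b] < closer [set a; b] < n.*2)%N.
  by move=> ab; rewrite H // opener_arcset ?closer_arcset ?ltn_ord // ab.
case: (ltngtP x y) => [||/val_inj/eqP]; [exact: K|rewrite finset.setUC; exact: K|].
by rewrite (negPf xy).
Qed.

Definition arcs n (o c : nat -> nat) : {set {set 'I_n.*2}} :=
  [set arcset n (o i) (c i) | i : 'I_n].

Notation le_closer := (fun B C => (closer B <= closer C)%N).

Section Arcs.
Variables (n : nat) (o c : nat -> nat).
Hypothesis D : arc_data n o c.

Let oc i : (i < n)%N -> (o i < c i)%N. Proof. by case: D => _ + _; apply. Qed.
Let cn i : (i < n)%N -> (c i < n.*2)%N. Proof. by case/(arc_lt D). Qed.

Let arcset_opener i : (i < n)%N -> opener (arcset n (o i) (c i)) = o i.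
Proof. by move=> ilt; rewrite opener_arcset ?oc ?cn. Qed.

Let arcset_closer i : (i < n)%N -> closer (arcset n (o i) (c i)) = c i.
Proof. by move=> ilt; rewrite closer_arcset ?oc ?cn. Qed.

Lemma arcs_matching : is_matching (arcs n o c).
Proof.
rewrite /is_matching /finset.partition; apply/andP; split; last first.
  by apply/forallP => B; apply/implyP => /imsetP[k _ ->]; rewrite card_arcset ?oc ?cn.
apply/and3P; split.
- apply/eqP/setP => x; rewrite finset.in_setT; apply/finset.bigcupP.
  have [k kn xE] := arc_cover D (ltn_ord x).
  exists (arcset n (o k) (c k)); first by apply/imsetP; exists (Ordinal kn).
  by rewrite inE; case: xE => ->; rewrite eqxx ?orbT.
- apply/finset.trivIsetP => B C /imsetP[k _ ->] /imsetP[m _ ->]; apply: contraR.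
  case/pred0Pn => x /=; rewrite !inE => /andP[].
  have km : o k = o m -> k = m by move=> /(arc_opener_inj D (ltn_ord k) (ltn_ord m))/val_inj.
  have cE : c k = c m -> k = m.
    by case: (ltngtP k m) => [km'|mk|/val_inj //] E;
      have := arc_closer_lt D (ltn_ord k) (ltn_ord m);
      have := arc_closer_lt D (ltn_ord m) (ltn_ord k); rewrite E ltnn ?km' ?mk.
  case/orP => /eqP ->; case/orP => /eqP.
  + by move=> /km ->.
  + by move/(arc_opener_closer D (ltn_ord k) (ltn_ord m)).
  + by move/esym/(arc_opener_closer D (ltn_ord m) (ltn_ord k)).
  + by move/cE ->.
- apply/negP => /imsetP[k _] /esym/(congr1 (fun B : {set _} => #|B|)).
  by rewrite card_arcset ?oc ?cn // cards0.
Qed.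

Lemma numbered_arcs i : (i < n)%N -> numbered_arc (arcs n o c) i = arcset n (o i) (c i).
Proof.
move=> ilt; rewrite /numbered_arc.
have s_perm : perm_eq (enum (arcs n o c)) (mkseq (fun i => arcset n (o i) (c i)) n).
  apply: uniq_perm; first exact: enum_uniq.
    apply/mkseq_uniqP => k m; rewrite !inE => kn mn /(congr1 (@opener n)).
    by rewrite !arcset_opener //; apply: (arc_opener_inj D).
  move=> B; rewrite mem_enum; apply/imsetP/mapP => [[k _ ->]|[k]].
    by exists (val k); rewrite ?mem_iota ?ltn_ord.
  by rewrite mem_iota => kn ->; exists (Ordinal kn).
have s_sort : sorted le_closer (mkseq (fun i => arcset n (o i) (c i)) n).
  apply/(sortedP finset.set0) => k; rewrite size_mkseq => kn.
  rewrite !nth_mkseq ?(ltnW kn) // !arcset_closer ?(ltnW kn) //.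
  by rewrite ltnW // (arc_closer_lt D) //; apply: ltnW.
rewrite (_ : sort _ _ = mkseq (fun i => arcset n (o i) (c i)) n) ?nth_mkseq //.
rewrite -[RHS](sorted_sort _ s_sort); last by move=> B C E; apply: leq_trans.
have memE B : B \in enum (arcs n o c) -> exists2 k, (k < n)%N & B = arcset n (o k) (c k).
  by rewrite (perm_mem s_perm) => /mapP[k]; rewrite mem_iota; exists k.
(* [le_closer] is antisymmetric only on the arcs at hand, whose closers are distinct. *)
apply/perm_sort_inP => //.
- by move=> B C _ _; apply: leq_total.
- by move=> B C E _ _ _; apply: leq_trans.
- move=> B C /memE[k kn ->] /memE[m mn ->]; rewrite !arcset_closer // -eqn_leq => /eqP E.
  suff -> : k = m by [].
  by case: (ltngtP k m) => // km; have := arc_closer_lt D kn mn;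
    have := arc_closer_lt D mn kn; rewrite E ltnn km.
Qed.

Lemma arcs_Nmatchings : (arcs n o c \in Nmatchings n) <-> no_left_nesting n o c.
Proof.
rewrite inE arcs_matching /=; split.
  move=> /forallP H k m kn mn okm; apply/negP => ckm.
  have arcP j : (j < n)%N -> arcset n (o j) (c j) \in arcs n o c.
    by move=> jn; apply/imsetP; exists (Ordinal jn).
  have /implyP/(_ (arcP k kn))/forallP/(_ (arcset n (o m) (c m))) := H (arcset n (o k) (c k)).
  move/implyP/(_ (arcP m mn)).
  by rewrite /left_nesting !arcset_opener // !arcset_closer // okm ltnSn -okm oc // ckm eqxx.
move=> NL; apply/forallP => B; apply/implyP => /imsetP[k _ ->].
apply/forallP => C; apply/implyP => /imsetP[m _ ->].
rewrite /left_nesting !arcset_opener // !arcset_closer //; apply/negP.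
case/and4P => _ _ ckm /eqP okm.
by have := NL _ _ (ltn_ord k) (ltn_ord m) okm; rewrite ckm.
Qed.

End Arcs.

Definition arc_opener n (M : {set {set 'I_n.*2}}) i := opener (numbered_arc M i).
Definition arc_closer n (M : {set {set 'I_n.*2}}) i := closer (numbered_arc M i).

Section Matching.
Variables (n : nat) (M : {set {set 'I_n.*2}}).
Hypothesis MP : is_matching M.

Local Notation o := (arc_opener M).
Local Notation c := (arc_closer M).

Let s := sort (fun B C : {set 'I_n.*2} => (closer B <= closer C)%N) (enum M).

Let M_part : finset.partition M [set: 'I_n.*2]. Proof. by case/andP: MP. Qed.

Let M_card2 B : B \in M -> #|B| = 2.
Proof. by move=> BM; case/andP: MP => _ /forallP/(_ B)/implyP/(_ BM)/eqP. Qed.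

Let s_mem B : (B \in s) = (B \in M).
Proof. by rewrite mem_sort mem_enum. Qed.

Let s_uniq : uniq s. Proof. by rewrite sort_uniq enum_uniq. Qed.

Let s_size : size s = n.
Proof.
rewrite size_sort -cardE; have := card_uniform_partition M_card2 M_part.
by rewrite finset.cardsT card_ord muln2 => /double_inj.
Qed.

Lemma numbered_arcE i : (i < n)%N -> numbered_arc M i = arcset n (o i) (c i) /\
  (o i < c i < n.*2)%N.
Proof.
by move=> ilt; apply/card2_arcset/M_card2; rewrite -s_mem mem_nth // s_size.
Qed.

Let s_closer_inj i j : (i < n)%N -> (j < n)%N -> c i = c j -> i = j.
Proof.
move=> ilt jn cij; apply/eqP; rewrite -(nth_uniq finset.set0 (s := s)) ?s_size //.
have [Ei /andP[_ ci]] := numbered_arcE ilt; have [Ej _] := numbered_arcE jn.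
have mem_s k : (k < n)%N -> nth finset.set0 s k \in M.
  by move=> kn; rewrite -s_mem mem_nth ?s_size.
have /and3P[_ /finset.trivIsetP triv _] := M_part.
have := triv _ _ (mem_s i ilt) (mem_s j jn).
case: eqP => // _ /(_ isT) /pred0P /(_ (Ordinal ci)) /=.
rewrite -[nth _ s i]/(numbered_arc M i) -[nth _ s j]/(numbered_arc M j) Ei Ej.
by rewrite !inE /= cij !eqxx !orbT.
Qed.

Lemma matching_arc_data : arc_data n o c.
Proof.
split.
(* The list [r] has [n.*2] entries and covers the [n.*2] points, so it has no repetition. *)
- set r := mkseq o n ++ mkseq c n.
  have r_size : size r = n.*2 by rewrite size_cat !size_mkseq addnn.
  have r_sub : {subset iota 0 n.*2 <= r}.
    move=> x; rewrite mem_iota => xn.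
    have : Ordinal (xn : (x < n.*2)%N) \in finset.cover M.
      by rewrite (finset.cover_partition M_part) finset.in_setT.
    case/finset.bigcupP => B; rewrite -s_mem => /(nthP finset.set0)[k].
    rewrite s_size => kn <-; rewrite -[nth _ s k]/(numbered_arc M k).
    rewrite (numbered_arcE kn).1 inE /= mem_cat.
    by case/orP => /eqP ->; rewrite map_f ?orbT // mem_iota.
  have r_uniq : uniq r.
    by apply: leq_size_uniq (iota_uniq 0 n.*2) r_sub _; rewrite r_size size_iota.
  have [|_ r_mem] := uniq_min_size (iota_uniq 0 n.*2) r_sub.
    by rewrite r_size size_iota.
  by apply: (uniq_perm r_uniq (iota_uniq 0 n.*2)) => x; rewrite r_mem.
- by move=> i /numbered_arcE[_ /andP[]].
- move=> i j ij jn; have ilt := ltn_trans ij jn.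
  rewrite ltn_neqAle; apply/andP; split.
    by apply: contraTneq ij => /(s_closer_inj ilt jn) ->; rewrite ltnn.
  have s_sorted : sorted (fun B C : {set 'I_n.*2} => (closer B <= closer C)%N) s.
    by apply: sort_sorted => B C; apply: leq_total.
  apply: (sorted_leq_nth _ _ finset.set0 s_sorted); rewrite ?inE ?s_size //.
  + by move=> B C E; apply: leq_trans.
  + exact: ltnW.
Qed.

Lemma matching_arcs : M = arcs n o c.
Proof.
apply/setP => B; rewrite -s_mem; apply/(nthP finset.set0)/imsetP => [[k]|[k _ ->]].
  rewrite s_size => kn <-; exists (Ordinal kn) => //.
  by have [<-] := numbered_arcE kn.
by exists k; rewrite ?s_size //; have [<-] := numbered_arcE (ltn_ord k).
Qed.

End Matching.

Definition matching_code n (M : {set {set 'I_n.*2}}) :=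
  mkseq (arc_code n (arc_opener M) (arc_closer M)) n.

Lemma Nmatching_data n (M : {set {set 'I_n.*2}}) : M \in Nmatchings n ->
  arc_data n (arc_opener M) (arc_closer M) /\
  no_left_nesting n (arc_opener M) (arc_closer M).
Proof.
move=> MN; have MP : is_matching M by move: MN; rewrite inE => /andP[].
have D := matching_arc_data MP; split=> //.
by apply/(arcs_Nmatchings D); rewrite -matching_arcs.
Qed.

Lemma arc_opener_arcs n o c : arc_data n o c -> forall i, (i < n)%N ->
  arc_opener (arcs n o c) i = o i /\ arc_closer (arcs n o c) i = c i.
Proof.
move=> D i ilt; have [_ cn] := arc_lt D ilt; have [_ oc _] := D.
by rewrite /arc_opener /arc_closer numbered_arcs // opener_arcset ?closer_arcset ?oc.
Qed.

(** Every code comes from its reconstructed arcs by [code_arc_code], and a matching is recovered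
    from its code by [arc_openerE] and [arc_closerE]. *)
Lemma matching_codes n :
  perm_eq [seq matching_code M | M in Nmatchings n] (codes n).
Proof.
apply: uniq_perm; first 1 last; first exact: codes_uniq.
- move=> d; rewrite mem_codes; apply/mapP/andP => [[M]|[/eqP dn /allP dP]].
    rewrite mem_enum => /Nmatching_data[D _] ->; rewrite size_mkseq eqxx; split=> //.
    apply/allP => i; rewrite mem_iota => ilt; rewrite nth_mkseq //.
    exact: arc_code_le.
  have d_le i : (i < n)%N -> (nth 0%N d i <= i)%N.
    by move=> ilt; apply: dP; rewrite mem_iota.
  have D := code_arc_data d_le;
  exists (arcs n (code_opener n (nth 0%N d)) (code_closer n (nth 0%N d))).
    by rewrite mem_enum; apply/(arcs_Nmatchings D); apply: code_no_left_nesting.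
  rewrite -[LHS](mkseq_nth 0%N) dn; apply/eq_in_map => i.
  rewrite mem_iota => ilt; rewrite -(code_arc_code d_le ilt).
  rewrite /arc_code (arc_opener_arcs D ilt).1; apply: eq_in_count => j.
  by rewrite mem_iota => jn; rewrite (arc_opener_arcs D jn).2.
- rewrite map_inj_in_uniq ?enum_uniq // => M M'; rewrite !mem_enum => MN MN' E.
  have [D NL] := Nmatching_data MN; have [D' NL'] := Nmatching_data MN'.
  have dE i : (i < n)%N -> arc_code n (arc_opener M) (arc_closer M) i =
      arc_code n (arc_opener M') (arc_closer M') i.
    by move=> ilt; have := congr1 (nth 0%N ^~ i) E; rewrite !nth_mkseq.
  have MP : is_matching M by move: MN; rewrite inE => /andP[].
  have MP' : is_matching M' by move: MN'; rewrite inE => /andP[].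
  rewrite (matching_arcs MP) (matching_arcs MP'); apply: eq_imset => k.
  have kn := ltn_ord k.
  rewrite (arc_openerE D NL kn) (arc_openerE D' NL' kn).
  rewrite (arc_closerE D kn) (arc_closerE D' kn).
  rewrite /code_opener /code_closer dE //; congr (arcset _ (_ + _)%N (_ + _)%N).
    by apply: eq_in_count => j; rewrite mem_iota => jn; rewrite /lex_lt !dE.
  by apply: eq_in_count => j; rewrite mem_iota => jn; rewrite dE.
Qed.

(** * The bracket of the matchings *)

Section MatchingBracket.
Variables (A : eqType) (K : comNzRingType) (s : K) (lt : mark -> ncps A K).

Section Sets.
Variables (n : nat) (M : {set {set 'I_n.*2}}).
Hypothesis MN : M \in Nmatchings n.

Local Notation d := (matching_code M).
Local Notation o := (arc_opener M).
Local Notation c := (arc_closer M).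

Let D : arc_data n o c. Proof. by case: (Nmatching_data MN). Qed.
Let NL : no_left_nesting n o c. Proof. by case: (Nmatching_data MN). Qed.
Let nth_d i : (i < n)%N -> nth 0%N d i = arc_code n o c i.
Proof. exact: nth_mkseq. Qed.

Let d0 : (0 < n)%N -> 0%N \in d.
Proof.
move=> n0; apply/(nthP 0%N); exists 0%N; rewrite ?size_mkseq // nth_d //.
by apply/eqP; rewrite -leqn0; apply: arc_code_le.
Qed.

Let notin_gt0 i : (i < n)%N -> i \notin d -> (0 < i)%N.
Proof. by case: i => // /d0 ->. Qed.

Lemma mem_Rne (i : 'I_n) : (i \in Rne M) = code_allowed d i mU.
Proof.
rewrite inE /= -!/(arc_opener _ _) -!/(arc_closer _ _).
have ilt := ltn_ord i; have [i0|i0] := posnP i.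
  by case: (boolP (_ \notin d)) => // /(notin_gt0 ilt); rewrite i0.
have i1 : (i.-1 < n)%N by lia.
have [_ /(_ _ i1) -> _] := D; rewrite (closer_succ D) // andbC !nth_d //=.
have ii : (i < i.-1)%N = false by lia.
by rewrite (opener_lt D NL) // /lex_lt ii andbF orbF andbT andbC.
Qed.

Lemma mem_LRcr (i : 'I_n) : (i \in LRcr M) = code_allowed d i mW.
Proof.
rewrite inE /= -!/(arc_opener _ _) -!/(arc_closer _ _).
have ilt := ltn_ord i; have [i0|i0] := posnP i.
  by case: (boolP (_ \notin d)) => // /(notin_gt0 ilt); rewrite i0.
have i1 : (i.-1 < n)%N by lia.
rewrite !nth_d // -(opener_succ D NL) // -(closer_succ D) //.
rewrite [RHS]andbC /=; congr (_ && _); apply: andb_idl => /eqP cE.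
have [_ /(_ _ ilt) + _] := D; rewrite cE ltnS leq_eqVlt => /predU1P[|//].
by move/(arc_opener_closer D ilt i1).
Qed.

Lemma mem_Rcr0 (i : 'I_n) : (i \in Rcr0 M) =
  ((i : nat) \notin d) && (nth 0%N d i.-1 < nth 0%N d i)%N.
Proof.
rewrite finset.in_setD mem_LRcr !inE /= -!/(arc_opener _ _) -!/(arc_closer _ _).
have ilt := ltn_ord i; have [i0|i0] := posnP i.
  by rewrite andbF; case: (boolP (_ \notin d)) => // /(notin_gt0 ilt); rewrite i0.
have i1 : (i.-1 < n)%N by lia.
rewrite -(closer_succ D) //; case: eqP => cE; rewrite ?andbF //= !andbT.
have -> : (o i < c i.-1)%N.
  have [_ /(_ _ ilt) + _] := D; rewrite cE ltnS leq_eqVlt => /predU1P[|//].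
  by move/(arc_opener_closer D ilt i1).
rewrite (opener_lt D NL) // /lex_lt !nth_d //; lia.
Qed.

(** An opener precedes the first closer exactly when its code is 0. *)
Lemma min_stat_code : min_stat M = count_mem 0%N d.
Proof.
rewrite /min_stat count_map -sum1_count -sum1_card [LHS]big_mkcond [RHS]big_mkcond.
rewrite (_ : iota 0 n = index_iota 0 n) ?big_mkord; last by rewrite /index_iota subn0.
apply: eq_bigr => i _.
rewrite inE -!/(arc_opener _ _) -!/(arc_closer _ _) /=.
rewrite (opener_lt_closer D) ?leqn0 //; by case: i => i /= /(leq_ltn_trans _) ->.
Qed.

End Sets.

Lemma Nbar_pathgf : let: u := lt mU in let: v := lt mV in let: w := lt mW in
  let: t := lt mT in
  Nbar (u + v + t) (v + t) (v + w + t) t s =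
  ncsum [set n | (1 <= n)%N]%classic (fun n => pathgf (wt_first s) lt n 0 0).
Proof.
apply: eq_ncsum => n.
rewrite -(sum_prod_allowed (r := codes n) (a := fun d => s ^+ count_mem 0%N d)
  (al := code_allowed)); last first.
  move=> x xn _; transitivity
    (\sum_(d <- codes n | code_compat (nth mT x) n d) s ^+ count_mem 0%N d).
    rewrite big_seq_cond [RHS]big_seq_cond; apply: eq_bigl => d.
    by case: (boolP (d \in codes n)) => // /code_allowedE ->.
  by rewrite code_sum_pathwt -xn mkseq_nth.
rewrite -(perm_big _ (matching_codes n)) big_map big_enum_cond /=.
apply: eq_big => [M|M MN]; first by rewrite andbT.
rewrite min_stat_code //; congr (_ *: _).
apply: eq_bigr => i _; rewrite /marks !big_cons big_nil /=.
rewrite mem_Rne // mem_LRcr // mem_Rcr0 //= andbT.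
case: (boolP (_ \notin _)) => //= _; rewrite ?addr0 //.
by case: (ltngtP (nth 0%N _ i) (nth 0%N _ i.-1)) => /= _; rewrite ?addr0 ?addrA.
Qed.

End MatchingBracket.

(** * Generating functions *)

Section GeneratingFunctions.
Variables (A : eqType) (K : comNzRingType).
Implicit Types (u v w t x y z : ncps A K) (s : K).

Definition mark_series u v w t c :=
  match c with mU => u | mV => v | mW => w | mT => t end.

Lemma SgfE u v w t s : Sgf u v w t s = ncsum [set n | (1 <= n)%N]%classic
  (fun n => pathgf (wt_last s) (mark_series u v w t) n 0 0).
Proof. exact: (Sbar_pathgf s (mark_series u v w t)). Qed.

Lemma NgfE u v w t s : Ngf u v w t s = ncsum [set n | (1 <= n)%N]%classic
  (fun n => pathgf (wt_first s) (mark_series u v w t) n 0 0).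
Proof. exact: (Nbar_pathgf s (mark_series u v w t)). Qed.

Lemma Sgf_sillyE u v t s : Sgf_silly u v t s = Sgf u v 0 t s.
Proof. by rewrite SgfE -(@Sbar_silly_pathgf _ _ s (mark_series u v 0 t)). Qed.

Lemma ord_ge0 n : ord_ge (0 : ncps A K) n.
Proof. by []. Qed.

Section Ord.
Variables (u v w t : ncps A K) (s : K).
Hypotheses (u1 : ord_ge u 1) (v1 : ord_ge v 1) (w1 : ord_ge w 1) (t1 : ord_ge t 1).
Hypothesis sw : s *: w = w.

Let lt := mark_series u v w t.
Let lt1 c : ord_ge (lt c) 1. Proof. by case: c. Qed.
Let g := blockser (wt_last s) lt.

Lemma Sgf_blockser : Sgf u v w t s = ncsum [set m | (1 <= m)%N]%classic
  (fun m => \prod_(1 <= k < m.+1) (t * (g k * (1 - v * g k)^-1))).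
Proof.
rewrite SgfE (ncsum_blockser lt1) // => k p _.
by rewrite /wt_last; case: ifP => _; rewrite ?scale1r.
Qed.

Lemma Ngf_blockser : Ngf u v w t s = ncsum [set m | (1 <= m)%N]%classic
  (fun m => \prod_(1 <= k < m.+1) (t * (g k * (1 - v * g k)^-1))).
Proof.
rewrite NgfE (ncsum_blockser lt1) => [|k p _].
  apply: eq_ncsum => m; rewrite [LHS]big_nat_cond [RHS]big_nat_cond.
  by apply: eq_bigr => k /andP[/andP[k0 _] _]; rewrite blockser_firstE.
by rewrite /wt_first; case: ifP => _; rewrite ?scale1r.
Qed.

Lemma Sgf_Ngf : Sgf u v w t s = Ngf u v w t s.
Proof. by rewrite Sgf_blockser Ngf_blockser. Qed.

End Ord.

(** The quotient exists because [(1 - v * g)^-1 - 1 = v * g * (1 - v * g)^-1]. *)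
Lemma ldiv_geometric (b : A) g :
  ldiv (letter K b) ((1 - letter K b * g)^-1 - 1) = g * (1 - letter K b * g)^-1.
Proof.
set v := letter K b.
have uV : 1 - v * g \is a GRing.unit.
  by apply: nc_unit1B; apply: ord_geMr; apply: letter_ord.
rewrite -[RHS](ldivK b) -/v; congr ldiv; rewrite mulrA.
by rewrite -[X in _ - X = _](mulrV uV) mulrBl mul1r opprB addrC subrK.
Qed.

(** The common source of both closed formulas, [s *: w = w] being satisfied by [s = 1] and by
    [w = 0]. *)
Lemma Ngf_ldiv (a b : A) w t s :
    let: u := letter K a in let: v := letter K b in
    ord_ge w 1 -> ord_ge t 1 -> s *: w = w ->
  Ngf u v w t s = ncsum [set m | (1 <= m)%N]%classic (fun m =>
    \prod_(1 <= k < m.+1) (t * ldiv v ((1 - v * ldiv u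
      ((1 + u * (1 - w)^-1) ^+ k.-1 * (1 + s *: (u * (1 - w)^-1)) - 1))^-1 - 1))).
Proof.
move=> w1 t1 sw; rewrite Ngf_blockser //; try exact: letter_ord.
apply: eq_ncsum => m; rewrite [LHS]big_nat_cond [RHS]big_nat_cond.
apply: eq_bigr => -[//|k] _ /=.
by rewrite -(mulr_blockser_last s (mark_series _ (letter K b) w t)) ldivK ldiv_geometric.
Qed.

(** The substitution [u = x - y], [v = y - t], [w = z - y] inverts the one that defines [Sgf] and
    [Ngf]. *)
Lemma Sbar_Nbar x y z t s :
    ord_ge x 1 -> ord_ge y 1 -> ord_ge z 1 -> ord_ge t 1 ->
    s *: (z - y) = z - y ->
  Sbar x y z t s = Nbar x y z t s.
Proof.
move=> x1 y1 z1 t1 sw.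
have B1 (f h : ncps A K) : ord_ge f 1 -> ord_ge h 1 -> ord_ge (f - h) 1.
  by move=> f1 h1; apply: ord_geD => //; apply: ord_geN.
have := @Sgf_Ngf (x - y) (y - t) (z - y) t s
  (B1 _ _ x1 y1) (B1 _ _ y1 t1) (B1 _ _ z1 y1) t1 sw.
by rewrite /Sgf /Ngf [y - t + (z - y)]addrC !addrA !subrK.
Qed.

Lemma Sbar_sillyE x y t s : Sbar_silly x y t s = Sbar x y y t s.
Proof.
have := Sgf_sillyE (x - y) (y - t) t s.
by rewrite /Sgf /Sgf_silly addr0 !addrA !subrK.
Qed.

End GeneratingFunctions.

Theorem theorem7p6 (R : realType) :
  let s : fps R[i] := fpsX R[i] in
  let l (i : 'I_4) : ncps 'I_4 (fps R[i]) := letter (fps R[i]) i in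
  (let u := l 0 in let v := l 1 in let w := l 2%:R in let t := l 3%:R in
   [/\ Sgf u v w t 1 = Ngf u v w t 1,
       Ngf u v w t 1 =
         ncsum [set m | (1 <= m)%N]%classic (fun m =>
           \prod_(1 <= k < m.+1)
             (t * ldiv v ((1 - v * ldiv u ((1 + u * (1 - w)^-1) ^+ k - 1))^-1
                          - 1))),
       Sgf u v 0 t s = Sgf_silly u v t s,
       Sgf_silly u v t s = Ngf u v 0 t s &
       Ngf u v 0 t s =
         ncsum [set m | (1 <= m)%N]%classic (fun m =>
           \prod_(1 <= k < m.+1)
             (t * ldiv v ((1 - v * ldiv u ((1 + u) ^+ k.-1 * (1 + s *: u) - 1))^-1
                          - 1)))]) /\
  (let x := l 0 in let y := l 1 in let z := l 2%:R in let t := l 3%:R in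
   [/\ Sbar x y z t 1 = Nbar x y z t 1,
       Sbar x y y t s = Sbar_silly x y t s &
       Sbar_silly x y t s = Nbar x y y t s]).
Proof.
move=> s l; have l1 i : ord_ge (l i) 1 by apply: letter_ord.
split=> /=; split; rewrite ?Sgf_sillyE ?Sbar_sillyE //.
- by apply: Sgf_Ngf => //; rewrite scale1r.
- rewrite (Ngf_ldiv _ _ (l1 _) (l1 _) (scale1r _)); apply: eq_ncsum => m.
  rewrite [LHS]big_nat_cond [RHS]big_nat_cond.
  (* For [s = 1] the last factor equals the base of the power, and [k.-1] becomes [k] because [k] is
     positive. *)
  by apply: eq_bigr => k /andP[/andP[k0 _] _]; rewrite scale1r -exprSr prednK.
- by apply: Sgf_Ngf => //; rewrite scaler0.
- rewrite (Ngf_ldiv _ _ (@ord_ge0 _ _ 1) (l1 _) (scaler0 _ _)); apply: eq_ncsum => m.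
  by apply: eq_bigr => k _; rewrite subr0 invr1 mulr1.
- by apply: Sbar_Nbar => //; rewrite scale1r.
- by apply: Sbar_Nbar => //; rewrite subrr scaler0.
Qed.
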